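(* Let $X$ be a finite set with $|X|\geq 3$ and let $(X,S)$ be a non-degenerate symmetric set-theoretical solution of the quantum Yang–Baxter equation which is not trivial and which is retractable. Let $G(X,S)$ be its structure group. Then: (i) $G(X,S)$ has a recurrent left order; (ii) the space of left orders of $G(X,S)$ is homeomorphic to the Cantor set; (iii) $G(X,S)$ has infinitely many Conradian left orders.
   Context: A set-theoretical solution is a pair $(X,S)$ with $S:X\times X\to X\times X$ a bijection written $S(x,y)=(g_x(y),f_y(x))$. It is non-degenerate if all $f_x,g_x$ are bijections of $X$; symmetric if $S\circ S=\mathrm{Id}$ and $S^{12}S^{23}S^{12}=S^{23}S^{12}S^{23}$ on $X^3$. It is trivial if $f_x=g_x=\mathrm{Id}_X$ for all $x$. The structure group is $G(X,S)=\langle X\mid xy=g_x(y)f_y(x),\ x,y\in X\rangle$. Retract relation: $x\equiv y$ iff $f_x=f_y$; this is a congruence and $X/\!\equiv$ carries an induced non-degenerate symmetric solution whose structure group is $\mathrm{Ret}^1(G)=G(X,S)/\!\equiv$; iterate $\mathrm{Ret}^{m+1}(G)=\mathrm{Ret}^1(\mathrm{Ret}^m(G))$. The solution is retractable if $\mathrm{Ret}^m(G)$ is cyclic for some $m\geq1$. A left order on a group $G$ is a strict total order with $g\prec h\Rightarrow fg\prec fh$. It is Conradian if for all $a,b\succ 1$ there is $n\in\mathbb{N}$ with $b\prec ab^n$. A left order on a countable group is recurrent if for every $g\in G$ and every finite chain $h_1\prec\dots\prec h_r$ there is a sequence $n_i\to\infty$ with $h_1g^{n_i}\prec\dots\prec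 h_rg^{n_i}$ for all $i$. The space of left orders $LO(G)$ is topologized as a subspace of the power set of $G$ (identifying an order with its positive cone, or with the set of pairs it relates) with the product (Tychonoff) topology. *)

(* Defs.v *)
From HB Require Import structures.
From mathcomp Require Import all_boot all_order all_algebra.
From mathcomp Require Import all_classical all_reals topology cantor.
Set Implicit Arguments. Unset Strict Implicit. Unset Printing Implicit Defensive.
Local Open Scope classical_set_scope.

Record group := Group {
  gcar :> Type;
  gmul : gcar -> gcar -> gcar;
  gone : gcar;
  ginv : gcar -> gcar;
  gmulA : forall a b c, gmul a (gmul b c) = gmul (gmul a b) c;
  gmul1 : forall a, gmul gone a = a;
  gmulV : forall a, gmul (ginv a) a = gone }.

Arguments gmul {g}. Arguments gone {g}. Arguments ginv {g}.

Definition gexp (G : group) (g : G) (n : nat) : G := iter n (fun x => gmul x g) gone.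
Arguments gexp : clear implicits.

Definition cyclic_group (G : group) : Prop :=
  exists c : G, forall h : G, exists n : nat, h = gexp G c n \/ h = ginv (gexp G c n).

(** * Set-theoretical solutions on a finite set X:
    S(x,y) = (g_x(y), f_y(x)), with sg x y = g_x(y), sf y x = f_y(x). *)
Record solution := Solution {
  scar : finType;
  sg : scar -> scar -> scar;
  sf : scar -> scar -> scar }.
Arguments sg : clear implicits. Arguments sf : clear implicits.

Definition solS (s : solution) (p : scar s * scar s) : scar s * scar s :=
  (sg s p.1 p.2, sf s p.2 p.1).

Definition S12 (s : solution) (t : scar s * scar s * scar s) :=
  let: (x, y, z) := t in let: (a, b) := solS (x, y) in (a, b, z).
Definition S23 (s : solution) (t : scar s * scar s * scar s) :=
  let: (x, y, z) := t in let: (b, c) := solS (y, z) in (x, b, c).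

Definition is_solution (s : solution) : Prop := bijective (@solS s).

Definition non_degenerate (s : solution) : Prop :=
  forall x : scar s, bijective (sf s x) /\ bijective (sg s x).

Definition symmetric_sol (s : solution) : Prop :=
  (forall p : scar s * scar s, solS (solS p) = p) /\
  (forall t : scar s * scar s * scar s, S12 (S23 (S12 t)) = S23 (S12 (S23 t))).

Definition trivial_sol (s : solution) : Prop :=
  forall x : scar s, (forall y, sf s x y = y) /\ (forall y, sg s x y = y).

(** * Structure group, characterised up to isomorphism by its presentation
    G(X,S) = < X | x y = g_x(y) f_y(x) >: a group G with a map iota : X -> G
    satisfying the relations, generated by iota(X), and universal. *)
Definition is_structure_group (s : solution) (G : group) (iota : scar s -> G) : Prop :=
  [/\ (forall x y, gmul (iota x) (iota y) = gmul (iota (sg s x y)) (iota (sf s y x))),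
      (forall P : G -> Prop, (forall x, P (iota x)) -> P gone ->
         (forall a b, P a -> P b -> P (gmul a b)) -> (forall a, P a -> P (ginv a)) ->
         forall h, P h) &
      (forall (H : group) (phi : scar s -> H),
         (forall x y, gmul (phi x) (phi y) = gmul (phi (sg s x y)) (phi (sf s y x))) ->
         exists psi : G -> H, (forall a b, psi (gmul a b) = gmul (psi a) (psi b)) /\
                              (forall x, psi (iota x) = phi x))].

Arguments is_structure_group : clear implicits.

(** * Retraction: x == y iff f_x = f_y; X/== represented by canonical
    representatives of the classes. *)
Section Retraction.
Variable s : solution.
Local Notation X := (scar s).

Definition ret_rel (x y : X) : bool := [forall z, sf s x z == sf s y z].

Definition canon (x : X) : X := odflt x [pick y | ret_rel y x].

Lemma ret_rel_canon x : ret_rel (canon x) x.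
Proof.
rewrite /canon; case: pickP => [y -> //|_] /=.
by apply/forallP => z.
Qed.

Lemma canon_canon x : canon (canon x) == canon x.
Proof.
have E : ret_rel (canon x) x := ret_rel_canon x.
have eqP' : forall y, ret_rel y (canon x) = ret_rel y x.
  move=> y; apply/forallP/forallP => H z; move: (H z) (forallP E z) => /eqP -> /eqP ->;
  by [].
rewrite {1}/canon (eq_pick eqP') -/(canon x) /canon.
case: pickP => [y Hy|] //=.
Qed.

Definition ret_car : finType := {x : X | canon x == x}.

Definition ret_cls (x : X) : ret_car := exist _ (canon x) (canon_canon x).

Definition retract : solution :=
  @Solution ret_car (fun a b => ret_cls (sg s (val a) (val b)))
                    (fun a b => ret_cls (sf s (val a) (val b))).
End Retraction.

Definition retractable (s : solution) : Prop :=
  exists m : nat, 1 <= m /\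
    exists (G : group) (iota : scar (iter m retract s) -> G),
      is_structure_group (iter m retract s) G iota /\ cyclic_group G.

Definition is_left_order (G : group) (lt : G -> G -> bool) : Prop :=
  [/\ (forall a, ~~ lt a a),
      (forall a b c, lt a b -> lt b c -> lt a c),
      (forall a b, a = b \/ lt a b \/ lt b a) &
      (forall a b c, lt a b -> lt (gmul c a) (gmul c b))].

(** Left orders identified with the set of pairs they relate: points of the
    power set {0,1}^(G x G) with the product topology. *)
Definition LOspace (G : group) : Type := prod_topology (fun _ : G * G => bool).

Definition LO (G : group) : set (LOspace G) :=
  [set o | is_left_order (fun a b : G => o (a, b))].

Definition conradian (G : group) (lt : G -> G -> bool) : Prop :=
  forall a b : G, lt gone a -> lt gone b -> exists n : nat, lt b (gmul a (gexp G b n.+1)).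

Definition recurrent (G : group) (lt : G -> G -> bool) : Prop :=
  forall (g : G) (hs : seq G), sorted lt hs ->
    exists n : nat -> nat,
      (forall N, exists i0, forall i, (i0 <= i)%N -> (N <= n i)%N) /\
      (forall i, sorted lt (map (fun h => gmul h (gexp G g (n i))) hs)).

Arguments LO : clear implicits.

Definition homeomorphic_to_cantor (T : topologicalType) (A : set T) : Prop :=
  exists (f : T -> cantor_space) (h : cantor_space -> T),
    [/\ (forall x, A x -> h (f x) = x),
        (forall c, A (h c) /\ f (h c) = c),
        {within A, continuous f} &
        continuous h].

(* Main.v *)
(* Write lambda_x = g_x. Sending x to (e_x, lambda_x) embeds G = G(X,S) into the
   semidirect product of Z^X and Sym(X), i.e. G carries an injective cocycle pi
   into Z^X over its permutation action on X, and the same holds, without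
   injectivity, for each X_m in the tower of retracts. An element whose level
   m+1 cocycle vanishes acts trivially on X_m, and the last retract is a point,
   so the kernels of the cocycles pi_m form a finite series of normal subgroups
   with free abelian quotients. Ordering G lexicographically along this series
   gives a left order which is invariant under conjugation by g^N as soon as
   g^N acts trivially on all the X_m; hence it is recurrent.

   For an arbitrary left order on a subgroup H of G, Hölder's theorem on the
   elements of H acting trivially, followed by averaging over the image of H
   in Sym(X), gives a nonzero order preserving homomorphism chi : H -> R. It
   follows that every left order is Conradian. If psi : H -> Z is independent
   of chi, the order can be perturbed to one with leading homomorphism
   M chi + psi, M large, possibly after passing to the convex subgroup ker chi.
   Let X_m be the last retract with at least 3 elements. Either
   |X_m| >= |X_{m+1}| + 2, and the corresponding kernel has rank at least two,
   or |X_m| = 3, |X_{m+1}| = 2, the class with two elements is fixed by G and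
   G maps onto a rank two abelian group. In both cases such a psi exists for
   every left order, so no left order is isolated, and a nonempty closed
   subset of a countable power of {0,1} without isolated points is a Cantor
   set. *)
Require Import Defs.
From mathcomp Require Import all_boot all_order all_algebra.
From mathcomp Require Import all_classical all_reals topology cantor.
From mathcomp Require Import fingroup perm cyclic zify ring lra Rstruct.
(* [fingroup] also exports a constant named [group]; [Defs.group] is meant. *)
Import Defs.
Set Implicit Arguments. Unset Strict Implicit. Unset Printing Implicit Defensive.
Import Order.TTheory GRing.Theory Num.Theory.
Local Open Scope classical_set_scope.

(** * Perfect subsets of the Cantor cube *)

Lemma cube_cvgP (I : Type) (F : set_system (prod_topology (fun _ : I => bool)))
  (x : prod_topology (fun _ : I => bool)) : Filter F ->
  (forall i, F [set y | y i = x i]) -> F --> x.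
Proof.
move=> FF H; apply/cvg_sup => i U [V] [[W] oW <-] WxN WU.
by apply: filterS (H i) => y /= yi; apply: WU; rewrite /= yi.
Qed.

Lemma cube_nbhs_coord (I : Type) (x : prod_topology (fun _ : I => bool)) (i : I) :
  nbhs x [set y : prod_topology (fun _ : I => bool) | y i = x i].
Proof.
have := @proj_continuous {classic I} (fun _ => bool) i x [set x i].
by apply; exact: discrete_set1.
Qed.

Section PerfectSubsetsOfCubes.
Variable I : Type.
Local Notation cube := (prod_topology (fun _ : I => bool)).

Variables (d : nat -> I) (A : set cube).
Hypothesis d_surj : forall i, exists n, d n = i.

Definition agree n (x y : cube) := forall k, (k < n)%N -> x (d k) = y (d k).

Hypothesis A_closed : forall x, (forall n, exists2 y, A y & agree n x y) -> A x.
Hypothesis A_perfect :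
  forall x n, A x -> exists y, [/\ A y, agree n x y & y <> x].
Hypothesis A_neq0 : exists x, A x.

Lemma agree_sym n x y : agree n x y -> agree n y x.
Proof. by move=> H k /H. Qed.

Lemma agree_trans n x y z : agree n x y -> agree n y z -> agree n x z.
Proof. by move=> H1 H2 k kn; rewrite H1 // H2. Qed.

Lemma agree_le m n x y : (m <= n)%N -> agree n x y -> agree m x y.
Proof. by move=> mn H k km; apply: H; apply: leq_trans km mn. Qed.

Lemma nbhs_agree n (x : cube) : nbhs x [set y | agree n x y].
Proof.
elim: n => [|n IH]; first by apply: filterS (filterT : nbhs x setT) => y _ k.
apply: filterS (filterI IH (cube_nbhs_coord x (d n))) => y [/= H1 H2] k.
by rewrite ltnS leq_eqVlt => /orP[/eqP->|/H1].
Qed.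

(** If [d] repeats a coordinate, the later position never branches, so [d] need not be injective. *)
Definition branches (x : cube) n : bool :=
  `[< exists y, [/\ A y, agree n x y & y (d n) <> x (d n)] >].

Definition nbranches (x : cube) n := count (branches x) (iota 0 n).

(** A witness for one point also serves the other, unless the two points differ at position n; then
    each is itself a witness for the other. *)
Lemma branches_agree x y n : A x -> A y -> agree n x y ->
  branches x n = branches y n.
Proof.
have dir u v : A u -> A v -> agree n u v -> branches u n -> branches v n.
  move=> Au Av uv /asboolP [w [Aw uw wn]]; apply/asboolP.
  have [E|N] := pselect (u (d n) = v (d n)).
    exists w; split=> //; last by rewrite -E.
    exact: agree_trans (agree_sym uv) uw.
  by exists u; split=> //; exact: agree_sym.
by move=> Ax Ay xy; apply/idP/idP; apply: dir => //; exact: agree_sym.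
Qed.

Lemma nbranches_agree x y n : A x -> A y -> agree n x y ->
  nbranches x n = nbranches y n.
Proof.
move=> Ax Ay xy; apply: eq_in_count => k; rewrite mem_iota /= add0n => kn.
by apply: branches_agree => //; apply: agree_le xy; exact: ltnW.
Qed.

Lemma nbranchesS x n : nbranches x n.+1 = (nbranches x n + branches x n)%N.
Proof. by rewrite /nbranches -addn1 iotaD count_cat /= add0n addn0. Qed.

Lemma nbranches_homo x m n : (m <= n)%N -> (nbranches x m <= nbranches x n)%N.
Proof.
move=> /subnKC <-; elim: (n - m)%N => [|k IH]; first by rewrite addn0.
by rewrite addnS nbranchesS (leq_trans IH) ?leq_addr.
Qed.

Lemma branch_pos_uniq x m n : branches x m -> branches x n ->
  nbranches x m = nbranches x n -> m = n.
Proof.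
wlog mn : m n / (m <= n)%N.
  move=> H; have [mn|/ltnW nm] := leqP m n; first exact: H.
  by move=> Bm Bn E; apply/esym/H.
move=> Bm Bn E; move: mn; rewrite leq_eqVlt => /orP[/eqP//|lt_mn].
by have := nbranches_homo x lt_mn; rewrite nbranchesS Bm E addn1 ltnn.
Qed.

(** Perfectness gives a second point of [A] with the same prefix; the first position where the two
    differ branches. *)
Lemma branches_infinite x n : A x -> exists2 m, (n <= m)%N & branches x m.
Proof.
move=> Ax; have [y [Ay xy neq]] := A_perfect n Ax.
have [k xyk] : exists k, y (d k) != x (d k).
  apply: contrapT => H; apply: neq; apply/funext => i.
  have [k <-] := d_surj i; apply: contrapT => N; apply: H.
  by exists k; apply/eqP.
have ex : exists k, y (d k) != x (d k) by exists k.
pose m := ex_minn ex.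
have [ym mmin] : y (d m) != x (d m) /\
    forall k, y (d k) != x (d k) -> (m <= k)%N by rewrite /m; case: ex_minnP.
exists m.
  by rewrite leqNgt; apply/negP => mn; move: ym; rewrite (xy _ mn) eqxx.
apply/asboolP; exists y; split=> //; last exact/eqP.
move=> j jm; apply/esym/eqP/negPn/negP => /mmin.
by rewrite leqNgt jm.
Qed.

(** There is a first branching position from any n on, and the count stays constant up to it; so no
    value k is skipped. *)
Lemma branch_pos_ex x k : A x -> exists2 n, branches x n & nbranches x n = k.
Proof.
move=> Ax.
have next n j : nbranches x n = j ->
    exists2 m, branches x m & nbranches x m = j.
  move=> nj; have [m nm Bm] := branches_infinite n Ax.
  have ex : exists m, (n <= m)%N && branches x m by exists m; rewrite nm.
  have [p /andP[np Bp] pmin] : exists2 p, (n <= p)%N && branches x p &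
      forall q, (n <= q)%N && branches x q -> (p <= q)%N.
    by exists (ex_minn ex); case: ex_minnP.
  exists p => //; rewrite -nj -(subnKC np).
  have : forall q, (q <= p - n)%N -> nbranches x (n + q) = nbranches x n.
    elim=> [|q IH] qp; first by rewrite addn0.
    rewrite addnS nbranchesS IH ?(ltnW qp) //.
    case: (boolP (branches x (n + q))) => [B|_]; last by rewrite addn0.
    have := pmin (n + q)%N; rewrite B leq_addr => /(_ isT).
    by rewrite leqNgt -ltn_subRL qp.
  by apply.
elim: k => [|k [n Bn nk]]; first exact: (next 0%N).
by apply: (next n.+1); rewrite nbranchesS Bn nk addn1.
Qed.

(** Bit k is the choice made at the k-th branching position; within [A] all other coordinates are
    forced by earlier ones. *)
Definition code (x : cube) : cantor_space := fun k =>
  x (d (xget 0%N [set n | branches x n /\ nbranches x n = k])).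

Lemma codeE x n : branches x n -> code x (nbranches x n) = x (d n).
Proof.
move=> Bn; rewrite /code; congr (x (d _)).
set S := [set _ | _]; have Sn : S n by [].
have [B1 E1] : S (xget 0%N S) by apply: xgetPex; exists n.
exact: branch_pos_uniq E1.
Qed.

Lemma code_inj x y : A x -> A y -> code x = code y -> x = y.
Proof.
move=> Ax Ay E.
have H n : agree n x y.
  elim: n => // n IH k; rewrite ltnS leq_eqVlt => /orP[/eqP->{k}|/IH//].
  apply: contrapT => N.
  have Bx : branches x n.
    by apply/asboolP; exists y; split=> // e; apply: N.
  have By : branches y n by rewrite -(branches_agree Ax Ay).
  apply: N; rewrite -(codeE Bx) -(codeE By) E.
  by rewrite (nbranches_agree Ax Ay).
apply/funext => i; have [k <-] := d_surj i.
exact: (H k.+1).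
Qed.

(** The k-th branching position n of [x] is shared by all points of [A] with the same first n
    coordinates, so bit k is determined by n + 1 coordinates. *)
Lemma code_continuous : {within A, continuous code}.
Proof.
apply/subspace_continuousP => x Ax.
apply: (@cube_cvgP nat) => k.
have [n Bn nk] := branch_pos_ex k Ax.
rewrite /= /nbhs /= /within /=.
apply: filterS (nbhs_agree n.+1 x) => y /= xy Ay.
have xyn : agree n x y by apply: agree_le xy.
have By : branches y n by rewrite -(branches_agree Ax Ay).
have ny : nbranches y n = k by rewrite -(nbranches_agree Ax Ay).
change (code y k = code x k).
by rewrite -{1}ny codeE // -xy // -(codeE Bn) nk.
Qed.

Definition flip n (y : cube) : cube :=
  xget y [set z | [/\ A z, agree n y z & z (d n) <> y (d n)]].

(** Every stage is a point of [A]. At a branching position with the wrong bit it moves to the other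
    branch, which leaves all earlier coordinates alone. *)
Fixpoint approx (c : cantor_space) n : cube :=
  if n is m.+1 then
    let y := approx c m in
    if branches y m && (y (d m) != c (nbranches y m)) then flip m y else y
  else xget point A.

Lemma flipP n y : branches y n ->
  [/\ A (flip n y), agree n y (flip n y) & flip n y (d n) <> y (d n)].
Proof. by move=> /asboolP Bn; exact: (xgetPex _ Bn). Qed.

Lemma approx_in c n : A (approx c n).
Proof.
elim: n => [|n IH] /=; first by apply: xgetPex.
by case: ifP => // /andP[/flipP[]].
Qed.

Lemma approxS c n : agree n (approx c n) (approx c n.+1).
Proof. by move=> k kn /=; case: ifP => // /andP[/flipP[_ H _] _]; exact: H. Qed.

Lemma approx_le c m n : (m <= n)%N -> agree m (approx c m) (approx c n).
Proof.
move=> /subnKC <-; elim: (n - m)%N => [|k IH]; first by rewrite addn0.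
rewrite addnS; apply: agree_trans IH _.
by apply: agree_le (@approxS c (m + k)); rewrite leq_addr.
Qed.

Definition decode (c : cantor_space) : cube := fun i =>
  let k := xget 0%N [set k | d k = i] in approx c k.+1 (d k).

Lemma decodeE c k n : (k < n)%N -> decode c (d k) = approx c n (d k).
Proof.
move=> kn; rewrite /decode; set j := xget _ _.
have dj : d j = d k by apply: (@xgetPex _ 0%N [set j | d j = d k]); exists k.
pose N := maxn n j.+1.
rewrite (@approx_le c j.+1 N) ?leq_maxr // dj.
by rewrite (@approx_le c n N) ?leq_maxl.
Qed.

Lemma decode_agree c n : agree n (decode c) (approx c n).
Proof. by move=> k kn; exact: decodeE. Qed.

Lemma decode_in c : A (decode c).
Proof.
by apply: A_closed => n; exists (approx c n); [exact: approx_in|exact: decode_agree].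
Qed.

Lemma decodeK c : code (decode c) = c.
Proof.
apply/funext => k; have [n Bn nk] := branch_pos_ex k (decode_in c).
have ag := @decode_agree c n.
have E1 := branches_agree (decode_in c) (approx_in c n) ag.
have E2 := nbranches_agree (decode_in c) (approx_in c n) ag.
have By : branches (approx c n) n by rewrite -E1.
have [_ _ fl] := flipP By.
rewrite -{1}nk codeE // (@decodeE c n n.+1) //=.
rewrite By -E2 nk /=; case: eqP => [//|neq] /=.
(* [flip] avoids a bit different from [c k]; as there are only two values, it equals [c k]. *)
by move: fl neq; case: (flip _ _ _); case: (approx _ _ _); case: (c k).
Qed.

Lemma decode_continuous : continuous decode.
Proof.
move=> c; apply: cube_cvgP => i; have [k <-] := d_surj i.
suff H n : nbhs c [set c' | approx c' n = approx c n].
  apply: filterS (H k.+1) => c' E.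
  change (decode c' (d k) = decode c (d k)).
  by rewrite !(@decodeE _ k k.+1) // E.
elim: n => [|n IH]; first by apply: filterS (filterT : nbhs c setT).
have nb := @cube_nbhs_coord nat c (nbranches (approx c n) n).
by apply: filterS (filterI IH nb) => c' [/= -> ->].
Qed.

Lemma perfect_cube_homeomorphic : @homeomorphic_to_cantor cube A.
Proof.
exists code, decode; split.
- move=> x Ax; apply: code_inj => //; first exact: decode_in.
  exact: decodeK.
- by move=> c; split; [exact: decode_in|exact: decodeK].
- exact: code_continuous.
- exact: decode_continuous.
Qed.

End PerfectSubsetsOfCubes.

Local Open Scope ring_scope.

(** * Ordered subgroups of Z^X and Hölder's theorem *)

Record zsubgroup (V : zmodType) (B : set V) : Prop := ZSubgroup {
  zsub0 : B 0;
  zsubD : forall a b, B a -> B b -> B (a + b);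
  zsubN : forall a, B a -> B (- a) }.

Section ZSubgroup.
Variables (V : zmodType) (B : set V).
Hypothesis sB : zsubgroup B.

Lemma zsub_muln a n : B a -> B (a *+ n).
Proof.
move=> Ba; elim: n => [|n IH]; first by rewrite mulr0n; exact: zsub0.
by rewrite mulrS; apply: zsubD.
Qed.

Lemma zsub_mulz a z : B a -> B (a *~ z).
Proof.
move=> Ba; case: z => n; first by rewrite -pmulrn; exact: zsub_muln.
by rewrite NegzE mulrNz -pmulrn; apply: zsubN => //; exact: zsub_muln.
Qed.

Lemma zsubB a b : B a -> B b -> B (a - b).
Proof. by move=> Ba Bb; apply: zsubD => //; apply: zsubN. Qed.

End ZSubgroup.

Record zcone (V : zmodType) (B Q : set V) : Prop := ZCone {
  zcone_sub : forall a, Q a -> B a;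
  zcone0 : ~ Q 0;
  zconeD : forall a b, Q a -> Q b -> Q (a + b);
  zcone_total : forall a, B a -> [\/ a = 0, Q a | Q (- a)] }.

Definition zle (V : zmodType) (Q : set V) a b := a = b \/ Q (b - a).

Section ZCone.
Variables (V : zmodType) (B Q : set V).
Hypotheses (sB : zsubgroup B) (cQ : zcone B Q).
Local Notation le := (zle Q).

Lemma zle_trans a b c : le a b -> le b c -> le a c.
Proof.
case=> [->//|ab] [<-|bc]; right => //.
by have := zconeD cQ ab bc; rewrite addrC addrA subrK.
Qed.

Lemma zleD a b c e : le a b -> le c e -> le (a + c) (b + e).
Proof.
move=> ab ce; apply: (@zle_trans _ (b + c)).
  case: ab => [->|ab]; [by left|right].
  by rewrite opprD addrACA subrr addr0.
case: ce => [->|ce]; [by left|right].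
by rewrite opprD addrACA subrr add0r.
Qed.

Lemma zle_muln a b n : le a b -> le (a *+ n) (b *+ n).
Proof.
move=> ab; elim: n => [|n IH]; first by rewrite !mulr0n; left.
by rewrite !mulrS; apply: zleD.
Qed.

Lemma zcone_muln a n : Q a -> Q (a *+ n.+1).
Proof.
move=> Qa; elim: n => [|n IH]; first by rewrite mulr1n.
by rewrite mulrS; apply: (zconeD cQ).
Qed.

Lemma zle_Q a b : Q a -> le a b -> Q b.
Proof.
move=> Qa [<-//|ab]; have := zconeD cQ Qa ab.
by rewrite addrCA subrr addr0.
Qed.

Lemma zle_lt_total a b : B a -> B b -> le a b \/ Q (a - b).
Proof.
move=> Ba Bb; case: (zcone_total cQ (zsubB sB Ba Bb)) => [/subr0_eq->|?|].
- by left; left.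
- by right.
- by rewrite opprB => ?; left; right.
Qed.

End ZCone.

Lemma natmul_bounded_eq0 (R : realType) (x c : R) :
  (forall q : nat, `|x * q.+1%:R| <= c) -> x = 0.
Proof.
move=> H; apply/eqP/negPn/negP => x0.
have xp : 0 < `|x| by rewrite normr_gt0.
have c0 : 0 <= c / `|x|.
  by rewrite divr_ge0 // ?(le_trans _ (H 0)).
have := Num.Theory.archi_boundP c0.
set k := Num.bound _; rewrite ltr_pdivrMr // => kc.
have := H k; rewrite normrM normr_nat => Hk.
have : c < c by apply: (lt_le_trans kc); apply: le_trans Hk; rewrite mulrC ler_pM2l // ler_nat.
by rewrite ltxx.
Qed.

Section Hoelder.
Variables (R : realType) (V : zmodType) (B Q : set V) (u : V).
Hypotheses (sB : zsubgroup B) (cQ : zcone B Q) (Qu : Q u).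
Hypothesis u_cofinal : forall b, B b -> exists m : nat, Q (u *+ m - b).
Local Notation le := (zle Q).

Let Bu : B u. Proof. exact: (zcone_sub cQ Qu). Qed.

Let le_uu (p p' : int) : le (u *~ p) (u *~ p') -> p <= p'.
Proof.
move=> H; rewrite leNgt; apply/negP => lt.
have : Q (u *~ p - u *~ p').
  rewrite -mulrzBr; have -> : p - p' = (absz (p - p')).-1.+1%:Z by lia.
  by rewrite -pmulrn; exact: (zcone_muln cQ).
case: H => [->|H]; first by rewrite subrr; exact: (zcone0 cQ).
by move=> /(zconeD cQ H); rewrite addrA subrK subrr; exact: (zcone0 cQ).
Qed.

Let mulz_muln (p : int) (n : nat) : (u *~ p) *+ n = u *~ (p * n%:Z).
Proof. by rewrite mulrzA -pmulrn. Qed.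

Let cross a (p p' : int) (q q' : nat) :
  le (u *~ p) (a *+ q) -> le (a *+ q') (u *~ p') -> p * q'%:Z <= p' * q%:Z.
Proof.
move=> /(zle_muln cQ q') H1 /(zle_muln cQ q) H2; apply: le_uu.
rewrite -!mulz_muln; apply: (zle_trans cQ H1); rewrite -mulrnA mulnC mulrnA.
exact: H2.
Qed.

(** The lower Dedekind cut of [a] measured in units of [u]. *)
Let Lset (a : V) : set R := [set r | exists p : int, exists q : nat,
  le (u *~ p) (a *+ q.+1) /\ r = p%:~R / q.+1%:R].

Let L a := sup (Lset a).

Let Lset_ub a (p' : int) (q' : nat) : le (a *+ q'.+1) (u *~ p') ->
  ubound (Lset a) (p'%:~R / q'.+1%:R).
Proof.
move=> H r [p [q [H1 ->]]]; rewrite ler_pdivrMr ?ltr0n // mulrAC.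
rewrite ler_pdivlMr ?ltr0n //.
by have := cross H1 H; rewrite -(ler_int R) !rmorphM.
Qed.

Let upper a : B a -> exists m : nat, le a (u *~ m%:Z).
Proof. by move=> /u_cofinal [m H]; exists m; right; rewrite -pmulrn. Qed.

Let lower a : B a -> exists m : nat, le (u *~ (- m%:Z)) a.
Proof.
move=> Ba; have [m H] := u_cofinal (zsubN sB Ba); exists m; right.
by rewrite mulrNz -pmulrn opprK addrC; move: H; rewrite opprK.
Qed.

Let has_supL a : B a -> has_sup (Lset a).
Proof.
move=> Ba; split.
  have [m H] := lower Ba; exists ((- m%:Z)%:~R / 1%:R), (- m%:Z), 0%N.
  by rewrite mulr1n.
have [m H] := upper Ba; exists ((m%:Z)%:~R / 1%:R); apply: Lset_ub.
by rewrite mulr1n.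
Qed.

Let L_ge a (p : int) (q : nat) : B a -> le (u *~ p) (a *+ q.+1) ->
  p%:~R <= L a * q.+1%:R.
Proof.
move=> Ba H; rewrite -ler_pdivrMr ?ltr0n //.
by apply: sup_ubound; [case: (has_supL Ba)|exists p, q].
Qed.

Let L_le a (p : int) (q : nat) : B a -> le (a *+ q.+1) (u *~ p) ->
  L a * q.+1%:R <= p%:~R.
Proof.
move=> Ba H; rewrite -ler_pdivlMr ?ltr0n //.
by apply: ge_sup; [case: (has_supL Ba)|exact: Lset_ub].
Qed.

Let floor_ex a : B a ->
  exists p : int, le (u *~ p) a /\ le a (u *~ (p + 1)).
Proof.
move=> Ba; have [m Hm] := lower Ba; have [m' Hm'] := upper Ba.
(* Shifting by the lower bound makes this a search over [nat]: the least k gives p = k - 1 - m, or p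
   = -m when k = 0. *)
have ex : exists k : nat, `[< le a (u *~ (k%:Z - m%:Z)) >].
  exists (m + m')%N; apply/asboolP.
  by have -> : (m + m')%N%:Z - m%:Z = m'%:Z by lia.
case: (ex_minnP ex) => -[|k] /asboolP Hk kmin.
  exists (0%:Z - m%:Z); split; first by rewrite sub0r.
  apply: (zle_trans cQ Hk); right.
  by rewrite -mulrzBr addrC addKr.
exists (k%:Z - m%:Z); split; last first.
  by have -> : k%:Z - m%:Z + 1 = k.+1%:Z - m%:Z by lia.
have Bk : B (u *~ (k%:Z - m%:Z)) by exact: zsub_mulz.
case: (zle_lt_total sB cQ Ba Bk) => [H|?]; last by right.
by have := kmin k; rewrite ltnn => H'; have := H' (introT (asboolP _) H).
Qed.

(** For n = q + 1, enclosing n a and n b between consecutive multiples of [u] confines n (L (a + b)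
    - L a - L b) to [-2, 2], whatever n is. *)
Let LD a b : B a -> B b -> L (a + b) = L a + L b.
Proof.
move=> Ba Bb; apply/subr0_eq/(@natmul_bounded_eq0 _ _ 2) => q.
have [pa [a1 a2]] := floor_ex (zsub_muln sB q.+1 Ba).
have [pb [b1 b2]] := floor_ex (zsub_muln sB q.+1 Bb).
have Bab := zsubD sB Ba Bb.
have ab1 : le (u *~ (pa + pb)) ((a + b) *+ q.+1).
  by rewrite mulrzDr mulrnDl; exact: (zleD cQ).
have ab2 : le ((a + b) *+ q.+1) (u *~ (pa + 1 + (pb + 1))).
  by rewrite [u *~ (_ + (pb + 1))]mulrzDr mulrnDl; exact: (zleD cQ).
move: (L_ge Ba a1) (L_le Ba a2) (L_ge Bb b1) (L_le Bb b2).
move: (L_ge Bab ab1) (L_le Bab ab2).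
rewrite !intrD mulrBl mulrDl ler_norml /=.
set x := L (a + b) * _; set y := L a * _; set z := L b * _.
by move=> *; apply/andP; split; lra.
Qed.

(** The order need not be Archimedean, since only [u] is assumed cofinal; hence [L] is nonnegative
    on [Q] but may vanish there. *)
Lemma hoelder : exists L : V -> R,
  [/\ forall a b, B a -> B b -> L (a + b) = L a + L b,
      forall b, Q b -> 0 <= L b & L u = 1].
Proof.
exists L; split=> //.
  move=> b Qb; have Bb := zcone_sub cQ Qb.
  have := @L_ge b 0 0 Bb; rewrite mulr1; apply.
  by right; rewrite mulr0z mulr1n subr0.
apply/eqP; rewrite eq_le; apply/andP; split.
  by have := @L_le u 1 0 Bu; rewrite mulr1; apply; left.
by have := @L_ge u 1 0 Bu; rewrite mulr1; apply; left.
Qed.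

End Hoelder.

(* The number of pivots of a subgroup of Z^X is its rank; working with
   pivots avoids passing to rational coefficients. *)
Section Pivots.
Variable X : finType.
Local Notation V := {ffun X -> int}.

Definition lead (x : X) (b : V) :=
  b x != 0 /\ forall y : X, (enum_rank y < enum_rank x)%N -> b y = 0.

Definition pivots (B : set V) : {set X} :=
  [set x : X | `[< exists2 b, B b & lead x b >]]%SET.

Lemma pivotsP (B : set V) x : x \in pivots B <-> exists2 b, B b & lead x b.
Proof. by rewrite finset.in_set; split=> [/asboolP|H] //; apply/asboolP. Qed.

Lemma lead_ex (b : V) : b <> 0 -> exists x, lead x b.
Proof.
move=> b0.
have ex : exists n, [exists x : X, (b x != 0) && (enum_rank x == n :> nat)].
  apply: contrapT => H; apply: b0; apply/ffunP => x; rewrite ffunE.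
  apply/eqP/negPn/negP => bx; apply: H; exists (enum_rank x : nat).
  by apply/existsP; exists x; rewrite bx eqxx.
case: (ex_minnP ex) => n /existsP[x /andP[bx /eqP xn]] nmin.
exists x; split=> // y; rewrite xn => yn; apply/eqP/negPn/negP => yb.
have := nmin (enum_rank y); rewrite leqNgt yn => H.
by apply: (notF (H _)); apply/existsP; exists y; rewrite yb eqxx.
Qed.

Lemma lead_opp x b : lead x b -> lead x (- b).
Proof.
move=> [bx lb]; split; first by rewrite ffunE oppr_eq0.
by move=> y /lb by0; rewrite ffunE by0 oppr0.
Qed.

Lemma pivots_sub (B C : set V) : C `<=` B -> pivots C \subset pivots B.
Proof.
move=> CB; apply/fintype.subsetP => x; move=> /pivotsP[b Cb lb].
by apply/pivotsP; exists b => //; apply: CB.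
Qed.

(** Gaussian elimination without division: cross-multiplying [b] with an element of [C] having the
    same pivot cancels that coordinate, at the cost of a nonzero factor. *)
Lemma pivots_commensurable (B C : set V) : zsubgroup B -> zsubgroup C ->
  C `<=` B -> pivots B \subset pivots C ->
  forall b, B b -> exists2 z : int, z != 0 & C (b *~ z).
Proof.
move=> sB sC CB piv.
(* [k] bounds the number of trailing coordinates in which [b] may be nonzero. *)
have step : forall k : nat, (k <= #|X|)%N -> forall b, B b ->
    (forall y : X, (enum_rank y + k < #|X|)%N -> b y = 0) ->
    exists2 z : int, z != 0 & C (b *~ z).
  elim=> [_ b Bb b0|k IH kX b Bb b0].
    exists 1 => //; have -> : b = 0.
      by apply/ffunP => y; rewrite ffunE b0 // addn0.
    by rewrite mul0rz; exact: zsub0.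
  have rk : (#|X| - k.+1 < #|X|)%N by lia.
  pose y0 := enum_val (Ordinal rk).
  have ry0 : enum_rank y0 = (#|X| - k.+1)%N :> nat by rewrite enum_valK.
  have only (y : X) : (enum_rank y + k < #|X|)%N ->
      (#|X| <= enum_rank y + k.+1)%N -> y = y0.
    move=> y1 y2; apply: enum_rank_inj; apply: ord_inj; rewrite ry0.
    by move: (enum_rank y : nat) y1 y2 => r; lia.
  have [by0|by0] := eqVneq (b y0) 0.
    apply: IH => //; first exact: ltnW.
    move=> y yk; have [yk'|yk'] := ltnP (enum_rank y + k.+1) #|X|; first exact: b0.
    by rewrite (only y).
  have : y0 \in pivots C.
    apply: (fintype.subsetP piv y0); apply/pivotsP; exists b => //; split=> // y yy0.
    apply: (b0 y); move: yy0; rewrite ry0; move: (enum_rank y : nat) => r; lia.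
  move=> /pivotsP[c Cc [cy0 lc]].
  have Bc := CB _ Cc.
  pose b' := b *~ c y0 - c *~ b y0.
  have Bb' : B b' by apply: zsubB => //; apply: zsub_mulz.
  have [y yk|z z0 Cz] := IH (ltnW kX) b' Bb'.
    rewrite /b'.
    have [yk'|yk'] := ltnP (enum_rank y + k.+1) #|X|.
      have cy : c y = 0 by apply: lc; rewrite ry0; move: (enum_rank y : nat) yk' => r; lia.
      by rewrite !ffunE !ffunMzE (b0 y) // cy !mul0rz subrr.
    rewrite (only y) //.
    by rewrite !ffunE !ffunMzE !mulrzz mulrC subrr.
  exists (c y0 * z); first by rewrite mulf_neq0.
  have -> : b *~ (c y0 * z) = b' *~ z + c *~ (b y0 * z).
    by rewrite /b' mulrzBl -!mulrzA subrK.
  by apply: zsubD => //; apply: zsub_mulz.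
move=> b Bb; apply: (step #|X|) => // y.
by rewrite ltnNge leq_addl.
Qed.

(** Take for [u] a sum of nonnegative elements, one for each pivot of [B]. The elements bounded on
    both sides by multiples of [u] form a subgroup with the same pivots, so it contains a nonzero
    multiple of every b in [B], and a bound for that multiple bounds b. *)
Lemma cofinal_ex (B Q : set V) : zsubgroup B -> zcone B Q -> (exists b, Q b) ->
  exists2 u, Q u & forall b, B b -> exists m : nat, Q (u *+ m - b).
Proof.
move=> sB cQ [q0 Qq0].
pose bx x := xget 0 [set b | [/\ B b, lead x b & zle Q 0 b]].
have bxP x : x \in pivots B -> [/\ B (bx x), lead x (bx x) & zle Q 0 (bx x)].
  move=> /pivotsP[b Bb lb].
  have : exists b, [/\ B b, lead x b & zle Q 0 b].
    case: (zcone_total cQ Bb) => [b0|Qb|Qb].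
    - by case: lb; rewrite b0 ffunE eqxx.
    - by exists b; split=> //; right; rewrite subr0.
    - exists (- b); split; [exact: zsubN|exact: lead_opp|].
      by right; rewrite subr0.
  by move=> H; exact: (xgetPex 0 H).
pose u := \sum_(x in pivots B) bx x.
have u0 : zle Q 0 u.
  rewrite /u; elim/big_ind: _ => [|a b a0 b0|x /bxP[]//]; first by left.
  by rewrite -[0]addr0; exact: (zleD cQ a0 b0).
have Bu : B u.
  rewrite /u; elim/big_ind: _ => [|a b Ba Bb|x /bxP[]//]; first exact: zsub0.
  exact: zsubD.
have u_mono (m n : nat) : (m <= n)%N -> zle Q (u *+ m) (u *+ n).
  move=> /subnK <-; rewrite mulrnDr -[X in zle _ X]add0r.
  apply: (zleD cQ); last by left.
  by rewrite -(mul0rn _ (n - m)); exact: (zle_muln cQ _ u0).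
pose C := [set v | [/\ B v, exists m : nat, zle Q v (u *+ m) &
                   exists m : nat, zle Q (- v) (u *+ m)]].
have sC : zsubgroup C.
  split.
  - split; [exact: zsub0| |]; exists 0%N; rewrite ?oppr0 mulr0n; by left.
  - move=> a b [Ba [m1 a1] [m2 a2]] [Bb [m3 b1] [m4 b2]]; split.
    + exact: zsubD.
    + by exists (m1 + m3)%N; rewrite mulrnDr; exact: (zleD cQ).
    + by exists (m2 + m4)%N; rewrite mulrnDr opprD; exact: (zleD cQ).
  - move=> a [Ba a1 a2]; split; [exact: zsubN| by [] |by rewrite opprK].
have piv : pivots B \subset pivots C.
  apply/fintype.subsetP => x xB; have [Bb lb b0] := bxP x xB.
  apply/pivotsP; exists (bx x) => //; split=> //.
    exists 1%N; rewrite mulr1n /u (bigD1 x) //= -[X in zle _ X]addr0.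
    apply: (zleD cQ); first by left.
    elim/big_ind: _ => [|a b a0 b0'|y /andP[/bxP[]//]]; first by left.
    by rewrite -[0]addr0; exact: (zleD cQ).
  exists 0%N; rewrite mulr0n; case: b0 => [<-|b0]; first by left; rewrite oppr0.
  by right; move: b0; rewrite opprK add0r subr0.
have bnd b : B b -> exists m : nat, zle Q b (u *+ m).
  move=> Bb.
  have CB : C `<=` B by move=> v [].
  have [z z0 Cz] := pivots_commensurable sB sC CB piv Bb.
  have [k Ck] : exists k : nat, C (b *+ k.+1).
    exists (absz z).-1.
    have -> : (absz z).-1.+1 = absz z by lia.
    case: (z) Cz z0 => n; first by rewrite -pmulrn.
    by rewrite NegzE mulrNz -pmulrn => /(zsubN sC); rewrite opprK abszN absz_nat.
  case: (zcone_total cQ Bb) => [->|Qb|Qb].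
  - by exists 0%N; rewrite mulr0n; left.
  - case: Ck => _ [m Hm] _; exists m; apply: (zle_trans cQ _ Hm).
    case: k {m Hm} => [|k]; first by rewrite mulr1n; left.
    by right; rewrite mulrS addrAC subrr add0r; exact: (zcone_muln cQ).
  - by exists 0%N; rewrite mulr0n; right; rewrite sub0r.
have Qu : Q u.
  (* If [u] were 0, the positive element [q0] would be at most 0. *)
  case: u0 => [u0|]; last by rewrite subr0.
  have [m] := bnd _ (zcone_sub cQ Qq0).
  rewrite -u0 mul0rn => /(zle_Q cQ Qq0) /(zcone0 cQ)[].
exists u => // b Bb; have [m Hm] := bnd b Bb; exists m.+1.
rewrite mulrS -addrA; case: Hm => [->|Hm]; first by rewrite subrr addr0.
exact: (zconeD cQ).
Qed.

End Pivots.

(** * Groups, positive cones and cocycles *)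

Section GroupTheory.
Variable G : group.
Implicit Types a b c g h : G.

Lemma gmulVr a : gmul a (ginv a) = gone.
Proof.
rewrite -[gmul a _]gmul1 -[gone in LHS](gmulV (ginv a)) -gmulA.
by rewrite [gmul (ginv a) (gmul _ _)]gmulA gmulV gmul1 gmulV.
Qed.

Lemma gmulr1 a : gmul a gone = a.
Proof. by rewrite -(gmulV a) gmulA gmulVr gmul1. Qed.

Lemma gmulK a b : gmul (ginv a) (gmul a b) = b.
Proof. by rewrite gmulA gmulV gmul1. Qed.

Lemma gmulKV a b : gmul a (gmul (ginv a) b) = b.
Proof. by rewrite gmulA gmulVr gmul1. Qed.

Lemma gmul_inj a b c : gmul a b = gmul a c -> b = c.
Proof. by move=> E; rewrite -(gmulK a b) E gmulK. Qed.

Lemma ginv_uniq a b : gmul a b = gone -> b = ginv a.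
Proof. by move=> E; rewrite -(gmulK a b) E gmulr1. Qed.

Lemma ginvK a : ginv (ginv a) = a.
Proof. by apply/esym/ginv_uniq/gmulV. Qed.

Lemma ginv1 : ginv gone = gone :> G.
Proof. by apply/esym/ginv_uniq/gmul1. Qed.

Lemma ginvM a b : ginv (gmul a b) = gmul (ginv b) (ginv a).
Proof. by apply/esym/ginv_uniq; rewrite -gmulA gmulKV gmulVr. Qed.

Lemma gexpS a n : gexp G a n.+1 = gmul (gexp G a n) a. Proof. by []. Qed.

Lemma gexpD a m n : gexp G a (m + n) = gmul (gexp G a m) (gexp G a n).
Proof.
elim: n => [|n IH]; first by rewrite addn0 gmulr1.
by rewrite addnS !gexpS IH gmulA.
Qed.

Definition gzexp a (z : int) : G :=
  match z with Posz n => gexp G a n | Negz n => ginv (gexp G a n.+1) end.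

Record is_subgroup (H : set G) : Prop := IsSubgroup {
  sub1 : H gone;
  subM : forall a b, H a -> H b -> H (gmul a b);
  subV : forall a, H a -> H (ginv a) }.

Lemma subX H a n : is_subgroup H -> H a -> H (gexp G a n).
Proof.
move=> sH Ha; elim: n => [|n IH]; first exact: sub1.
by rewrite gexpS; apply: subM.
Qed.

Lemma subZ H a z : is_subgroup H -> H a -> H (gzexp a z).
Proof.
move=> sH Ha; case: z => n; first exact: subX.
by apply: (subV sH); exact: (@subX _ _ n.+1).
Qed.

Lemma subT : is_subgroup setT. Proof. by split. Qed.

Definition hom_on (V : zmodType) (H : set G) (phi : G -> V) :=
  forall a b, H a -> H b -> phi (gmul a b) = phi a + phi b.

Lemma hom_onS (V : zmodType) (H K : set G) (phi : G -> V) :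
  K `<=` H -> hom_on H phi -> hom_on K phi.
Proof. by move=> KH hphi a b /KH Ka /KH Kb; exact: hphi. Qed.

Section HomOn.
Variables (V : zmodType) (H : set G) (phi : G -> V).
Hypotheses (sH : is_subgroup H) (hphi : hom_on H phi).

Lemma hom_on1 : phi gone = 0.
Proof.
have := hphi (sub1 sH) (sub1 sH); rewrite gmul1 => /eqP.
by rewrite -subr_eq subrr eq_sym => /eqP.
Qed.

Lemma hom_onV a : H a -> phi (ginv a) = - phi a.
Proof.
move=> Ha; apply/eqP; rewrite -subr_eq0 opprK -hphi //; last exact: subV.
by rewrite gmulV hom_on1.
Qed.

Lemma hom_onX a n : H a -> phi (gexp G a n) = phi a *+ n.
Proof.
move=> Ha; elim: n => [|n IH]; first by rewrite mulr0n hom_on1.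
by rewrite gexpS hphi ?IH -?mulrSr //; exact: subX.
Qed.

Lemma hom_onZ a z : H a -> phi (gzexp a z) = phi a *~ z.
Proof.
move=> Ha; case: z => n; first by rewrite -pmulrn; exact: hom_onX.
by rewrite hom_onV ?hom_onX ?NegzE ?mulrNz // -?gexpS; exact: subX.
Qed.

Lemma ker_subgroup : is_subgroup [set h | H h /\ phi h = 0].
Proof.
split; first by split; [exact: sub1|exact: hom_on1].
  move=> a b [Ha a0] [Hb b0]; split; first exact: subM.
  by rewrite hphi // a0 b0 addr0.
by move=> a [Ha a0]; split; [exact: subV|rewrite hom_onV // a0 oppr0].
Qed.

End HomOn.

Record cone (H P : set G) : Prop := Cone {
  cone_sub : forall a, P a -> H a;
  cone1 : ~ P gone;
  coneM : forall a b, P a -> P b -> P (gmul a b);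
  cone_total : forall a, H a -> [\/ a = gone, P a | P (ginv a)] }.

Lemma cone_asym (H P : set G) a : cone H P -> P a -> ~ P (ginv a).
Proof. by move=> cP Pa /(coneM cP Pa); rewrite gmulVr; exact: cone1 cP. Qed.

Lemma coneX (H P : set G) a n : cone H P -> P a -> P (gexp G a n.+1).
Proof.
move=> cP Pa; elim: n => [|n IH]; first by rewrite /= gmul1.
by rewrite gexpS; apply: (coneM cP).
Qed.

Lemma cone_restrict (H C P : set G) : is_subgroup C -> C `<=` H ->
  cone H P -> cone C (C `&` P).
Proof.
move=> sC CH cP; split.
- by move=> a [].
- by move=> [_]; exact: cone1 cP.
- by move=> a b [Ca Pa] [Cb Pb]; split; [exact: subM|exact: (coneM cP)].
- move=> a Ca; case: (cone_total cP (CH _ Ca)) => [->|Pa|Pa].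
  + by constructor 1.
  + by constructor 2.
  + by constructor 3; split=> //; exact: subV.
Qed.

End GroupTheory.
Arguments subT {G}.

Section PermAction.
Variable X : finType.
Implicit Types (s t : {perm X}) (v w : {ffun X -> int}).

Definition pact s v : {ffun X -> int} := [ffun x => v ((s^-1)%g x)].

Lemma pact1 v : pact 1%g v = v.
Proof. by apply/ffunP => x; rewrite ffunE invg1 perm1. Qed.

Lemma pactM s t v : pact (t * s)%g v = pact s (pact t v).
Proof. by apply/ffunP => x; rewrite !ffunE invMg permM. Qed.

Lemma pactD s v w : pact s (v + w) = pact s v + pact s w.
Proof. by apply/ffunP => x; rewrite !ffunE. Qed.

Lemma pactN s v : pact s (- v) = - pact s v.
Proof. by apply/ffunP => x; rewrite !ffunE. Qed.

Lemma pact0 s : pact s 0 = 0.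
Proof. by apply/ffunP => x; rewrite !ffunE. Qed.

Lemma pactMn s v n : pact s (v *+ n) = pact s v *+ n.
Proof.
by elim: n => [|n IH]; rewrite ?mulr0n ?pact0 // !mulrS pactD IH.
Qed.

End PermAction.

(** Permutations multiply from left to right here, so [rhoM] makes [rho] a homomorphism for the
    usual composition. The two laws say that g |-> (pi g, rho g) is a homomorphism into the
    semidirect product of Z^X and Sym(X). *)
Record cocycle (G : group) (X : finType) (rho : G -> {perm X})
    (pi : G -> {ffun X -> int}) : Prop := Cocycle {
  rhoM : forall g h, rho (gmul g h) = (rho h * rho g)%g;
  piM : forall g h, pi (gmul g h) = pi g + pact (rho g) (pi h) }.

Section Cocycle.
Variables (G : group) (X : finType).
Variables (rho : G -> {perm X}) (pi : G -> {ffun X -> int}).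
Hypothesis cc : cocycle rho pi.

Lemma rho1 : rho gone = 1%g.
Proof. by apply: (mulgI (rho gone)); rewrite -(rhoM cc) gmul1 mulg1. Qed.

Lemma rhoV g : rho (ginv g) = (rho g)^-1%g.
Proof. by apply: (mulgI (rho g)); rewrite -(rhoM cc) gmulV mulgV rho1. Qed.

Lemma rhoX g n : rho (gexp G g n) = (rho g ^+ n)%g.
Proof. by elim: n => [|n IH]; rewrite ?rho1 // gexpS (rhoM cc) IH expgS. Qed.

Lemma rhoX_card g : rho (gexp G g #|{perm X}|) = 1%g.
Proof. by rewrite rhoX -cardsT; apply/expg_cardG/finset.in_setT. Qed.

Lemma pi1 : pi gone = 0.
Proof.
have := piM cc gone gone; rewrite gmul1 rho1 pact1 => /eqP.
by rewrite -subr_eq subrr eq_sym => /eqP.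
Qed.

Lemma piV g : pi (ginv g) = - pact (rho g)^-1%g (pi g).
Proof.
have := piM cc (ginv g) g; rewrite gmulV pi1 rhoV => /esym/eqP.
by rewrite addr_eq0 => /eqP.
Qed.

Lemma pi_triv g h : rho g = 1%g -> pi (gmul g h) = pi g + pi h.
Proof. by move=> rg; rewrite (piM cc) rg pact1. Qed.

Lemma pi_trivV g : rho g = 1%g -> pi (ginv g) = - pi g.
Proof. by move=> rg; rewrite piV rg invg1 pact1. Qed.

Lemma pi_trivX g n : rho g = 1%g -> pi (gexp G g n) = pi g *+ n.
Proof.
move=> rg; elim: n => [|n IH]; first by rewrite pi1.
by rewrite gexpS pi_triv ?IH -?mulrSr // rhoX rg expg1n.
Qed.

Lemma pi_conj g h : rho h = 1%g ->
  pi (gmul g (gmul h (ginv g))) = pact (rho g) (pi h).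
Proof.
move=> rh; rewrite (piM cc) (pi_triv _ rh) pactD piV pactN -pactM.
by rewrite mulVg pact1 addrC -addrA addNr addr0.
Qed.

Lemma rho_conj g h : rho h = 1%g -> rho (gmul g (gmul h (ginv g))) = 1%g.
Proof. by move=> rh; rewrite !(rhoM cc) rh mulg1 rhoV mulVg. Qed.

End Cocycle.

(** * The homomorphism to R attached to a left order *)

Section AdditiveOn.
Variables (V W : zmodType) (B : set V) (L : V -> W).
Hypotheses (sB : zsubgroup B).
Hypothesis LD : forall a b, B a -> B b -> L (a + b) = L a + L b.

Lemma additive_on0 : L 0 = 0.
Proof.
have := LD (zsub0 sB) (zsub0 sB); rewrite addr0 => /eqP.
by rewrite -subr_eq subrr eq_sym => /eqP.
Qed.

Lemma additive_onN a : B a -> L (- a) = - L a.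
Proof.
move=> Ba; apply/eqP; rewrite -addr_eq0 -LD //; last exact: zsubN.
by rewrite addNr additive_on0.
Qed.

Lemma additive_onMn a n : B a -> L (a *+ n) = L a *+ n.
Proof.
move=> Ba; elim: n => [|n IH]; first by rewrite !mulr0n additive_on0.
by rewrite !mulrS LD ?IH //; exact: zsub_muln.
Qed.

Lemma additive_onMz a z : B a -> L (a *~ z) = L a *~ z.
Proof.
move=> Ba; case: z => n; first by rewrite -!pmulrn additive_onMn.
by rewrite NegzE !mulrNz -!pmulrn additive_onN ?additive_onMn //; exact: zsub_muln.
Qed.

End AdditiveOn.

Section OrderHom.
Variables (R : realType) (G : group) (X : finType).
Variables (rho : G -> {perm X}) (pi : G -> {ffun X -> int}).
Hypothesis cc : cocycle rho pi.
Hypothesis pi_eq0 : forall g, pi g = 0 -> g = gone.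

Definition lattice (H : set G) : set {ffun X -> int} :=
  [set v | exists h, [/\ H h, rho h = 1%g & pi h = v]].

Lemma pi_inj g h : pi g = pi h -> g = h.
Proof.
move=> E; apply: (@gmul_inj _ (ginv g)); rewrite gmulV; apply/esym/pi_eq0.
by rewrite (piM cc) -E -(piM cc) gmulV (pi1 cc).
Qed.

Lemma lattice_subgroup H : is_subgroup H -> zsubgroup (lattice H).
Proof.
move=> sH; split.
- by exists gone; split; [exact: sub1|exact: rho1 cc|exact: pi1 cc].
- move=> a b [g [Hg rg <-]] [h [Hh rh <-]]; exists (gmul g h); split.
  + exact: subM.
  + by rewrite (rhoM cc) rg rh mulg1.
  + by rewrite (pi_triv cc).
- move=> a [g [Hg rg <-]]; exists (ginv g); split; first exact: subV.
  + by rewrite (rhoV cc) rg invg1.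
  + by rewrite (pi_trivV cc).
Qed.

Lemma lattice_cone H P : cone H P -> zcone (lattice H) (lattice P).
Proof.
move=> cP; split.
- by move=> a [g [Pg rg <-]]; exists g; split=> //; exact: (cone_sub cP).
- by move=> [g [Pg _ /pi_eq0 g1]]; apply: (cone1 cP); rewrite -g1.
- move=> a b [g [Hg rg <-]] [h [Hh rh <-]]; exists (gmul g h); split.
  + exact: (coneM cP).
  + by rewrite (rhoM cc) rg rh mulg1.
  + by rewrite (pi_triv cc).
- move=> a [g [Hg rg <-]]; case: (cone_total cP Hg) => [->|Pg|Pg].
  + by constructor 1; exact: pi1 cc.
  + by constructor 2; exists g.
  + constructor 3; exists (ginv g); split=> //.
      by rewrite (rhoV cc) rg invg1.
    by rewrite (pi_trivV cc).
Qed.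

Lemma latticeP_inv P g : rho g = 1%g -> lattice P (pi g) -> P g.
Proof. by move=> rg [h [Ph rh /pi_inj <-]]. Qed.

Lemma gexpSl (g : G) n : gexp G g n.+1 = gmul g (gexp G g n).
Proof. by rewrite -add1n gexpD /= gmul1. Qed.

Section Cone.
Variables (H P : set G).
Hypotheses (sH : is_subgroup H) (cP : cone H P) (P_neq0 : exists h, P h).

Let N := #|{perm X}|.
Let N_gt0 : (0 < N)%N. Proof. by apply/card_gt0P; exists 1%g. Qed.
Local Notation B := (lattice H).
Local Notation Q := (lattice P).
Let sB := lattice_subgroup sH.
Let cQ := lattice_cone cP.

Let latX h : H h -> B (pi (gexp G h N)).
Proof. by move=> Hh; exists (gexp G h N); split=> //; [exact: subX|exact: (rhoX_card cc)]. Qed.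

Let drop_right c h n : P (ginv h) -> P (gmul c (gexp G h n.+1)) -> P (gmul c h).
Proof.
move=> Ph; elim: n => [|n IH]; first by rewrite /= gmul1.
move=> H1; apply: IH; have := coneM cP H1 Ph.
by rewrite gexpS -!gmulA gmulVr gmulr1.
Qed.

Let drop_left c h n : P (ginv h) -> P (gmul (gexp G h n.+1) c) -> P (gmul h c).
Proof.
move=> Ph; elim: n => [|n IH]; first by rewrite /= gmul1.
move=> H1; apply: IH; have := coneM cP Ph H1.
by rewrite gexpSl -!gmulA gmulK.
Qed.

Section Functional.
Variables (L : {ffun X -> int} -> R) (u : {ffun X -> int}).
Hypothesis LD : forall a b, B a -> B b -> L (a + b) = L a + L b.
Hypothesis L_ge0 : forall b, Q b -> 0 <= L b.
Hypothesis Bu : B u.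
Hypothesis Lu : L u = 1.

Let L_gt0 b : B b -> 0 < L b -> Q b.
Proof.
move=> Bb Lb; case: (zcone_total cQ Bb) => [b0|//|/L_ge0].
  by move: Lb; rewrite b0 (additive_on0 sB LD) ltxx.
by rewrite (additive_onN sB LD) // oppr_ge0 leNgt Lb.
Qed.

Let big_multiple b w : B b -> 0 < L b -> B w ->
  exists m : nat, Q (b *+ m.+1 + w).
Proof.
move=> Bb Lb Bw.
have c0 : 0 <= `|L w| / L b by rewrite divr_ge0 // ltW.
exists (Num.bound (`|L w| / L b)).
have := archi_boundP c0; set k := Num.bound _.
rewrite ltr_pdivrMr // => kL; have Bbk := zsub_muln sB k.+1 Bb.
apply: L_gt0; first exact: zsubD.
rewrite LD // (additive_onMn sB LD) // mulrSr -mulr_natl.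
have : - `|L w| <= L w by rewrite lerNnormlW.
lra.
Qed.

(* An element of positive [L]-value is cofinal on both sides, so the product
   of the two bounds for [g] and [g^-1] exhibits a conjugate of a power of it
   as a product of positive elements. *)
Let pact_cofinal g b : H g -> B b -> 0 < L b -> 0 <= L (pact (rho g) b).
Proof.
move=> Hg Bb Lb; have [c [Hc rc cb]] := Bb.
have Pc : P c by apply: latticeP_inv => //; rewrite cb; exact: L_gt0.
have N1 : N = N.-1.+1 by rewrite prednK.
have rcX n : rho (gexp G c n) = 1%g by rewrite (rhoX cc) rc expg1n.
have rN h : rho (gexp G h N) = 1%g by exact: (rhoX_card cc).
have right h : H h -> exists m, P (gmul (gexp G c m.+1) h).
  move=> Hh; have [m Qm] := big_multiple Bb Lb (latX Hh).
  exists m; case: (cone_total cP Hh) => [->|Ph|Ph].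
  - by rewrite gmulr1; exact: coneX cP Pc.
  - by apply: (coneM cP) => //; exact: coneX cP Pc.
  (* For negative [h], the power h^N acts trivially, so the estimate in the lattice applies to it;
     [drop_right] then removes the surplus factors. *)
  - apply: (@drop_right _ _ N.-1 Ph); rewrite -N1; apply: latticeP_inv.
      by rewrite (rhoM cc) rN rcX mulg1.
    by rewrite (pi_triv cc) // (pi_trivX cc _ rc) cb.
have left h : H h -> exists m, P (gmul h (gexp G c m.+1)).
  move=> Hh; have [m Qm] := big_multiple Bb Lb (latX Hh).
  exists m; case: (cone_total cP Hh) => [->|Ph|Ph].
  - by rewrite gmul1; exact: coneX cP Pc.
  - by apply: (coneM cP) => //; exact: coneX cP Pc.
  - apply: (@drop_left _ _ N.-1 Ph); rewrite -N1; apply: latticeP_inv.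
      by rewrite (rhoM cc) rN rcX mulg1.
    by rewrite (pi_triv cc) // (pi_trivX cc _ rc) cb addrC.
have [m1 P1] := left g Hg; have [m2 P2] := right (ginv g) (subV sH Hg).
have := coneM cP P1 P2; rewrite -gmulA [gmul (gexp _ _ _) (gmul _ _)]gmulA -gexpD.
set k := (m1.+1 + m2.+1)%N => Pk.
have : 0 <= L (pact (rho g) (pi (gexp G c k))).
  apply: L_ge0; exists (gmul g (gmul (gexp G c k) (ginv g))); split=> //.
    exact: (rho_conj cc).
  exact: (pi_conj cc).
rewrite (pi_trivX cc _ rc) cb pactMn (additive_onMn sB LD) ?pmulrn_lge0 //.
exists (gmul g (gmul c (ginv g))); split.
- by do 2!apply: (subM sH) => //; exact: subV.
- exact: (rho_conj cc).
- by rewrite (pi_conj cc) // cb.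
Qed.

Let pact_lattice g b : H g -> B b -> B (pact (rho g) b).
Proof.
move=> Hg [c [Hc rc <-]]; exists (gmul g (gmul c (ginv g))); split.
- by do 2!apply: (subM sH) => //; exact: subV.
- exact: (rho_conj cc).
- by rewrite (pi_conj cc).
Qed.

(** If L b = 0, then u + z b has value 1 for every integer z, so L (g u) + z L (g b) >= 0 for all z,
    which excludes L (g b) < 0. *)
Let pact_ge0 g b : H g -> B b -> 0 <= L b -> 0 <= L (pact (rho g) b).
Proof.
move=> Hg Bb; rewrite le_eqVlt => /orP[/eqP Lb|]; last exact: pact_cofinal.
have key (z : int) : 0 <= L (pact (rho g) u) + L (pact (rho g) b) *~ z.
  have Bbz : B (b *~ z) by exact: zsub_mulz.
  have BS : B (pact (rho g) b) by exact: pact_lattice.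
  have E : pact (rho g) (b *~ z) = pact (rho g) b *~ z.
    case: (z) => n; first by rewrite -!pmulrn pactMn.
    by rewrite NegzE !mulrNz -!pmulrn pactN pactMn.
  rewrite -(additive_onMz sB LD) // -E -LD //; last 2 first.
  - exact: pact_lattice.
  - by rewrite E; exact: zsub_mulz.
  rewrite -pactD; apply: pact_cofinal => //; first exact: zsubD.
  by rewrite LD // (additive_onMz sB LD) // -Lb mul0rz Lu addr0.
rewrite leNgt; apply/negP => neg.
set y := L (pact (rho g) b) in neg key *; set x := L (pact (rho g) u) in key.
have x0 : 0 <= x by have := key 0; rewrite mulr0z addr0.
have c0 : 0 <= x / (- y) by rewrite divr_ge0 // oppr_ge0 ltW.
have := archi_boundP c0; set k := Num.bound _; rewrite ltr_pdivrMr ?oppr_gt0 // => kx.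
have := key k; rewrite -pmulrn -mulr_natl; lra.
Qed.

Let img : {set {perm X}} := [set s : {perm X} | `[< exists2 h, H h & rho h = s >]]%SET.

Let imgP s : s \in img <-> exists2 h, H h & rho h = s.
Proof. by rewrite finset.in_set; split=> [/asboolP|h] //; apply/asboolP. Qed.

Let avg h : {ffun X -> int} := \sum_(s in img) pact s (pi h).

(** Summing over the image of [H] in Sym(X) absorbs the twist of the cocycle by reindexing. *)
Let avgM : hom_on H avg.
Proof.
move=> a b Ha Hb; rewrite /avg; under eq_bigr do rewrite (piM cc) pactD.
rewrite big_split /=; congr (_ + _).
under eq_bigr do rewrite -pactM.
rewrite [RHS](reindex_inj (mulgI (rho a))) /=; apply: eq_bigl => s.
apply/idP/idP => /imgP[h Hh hs]; apply/imgP.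
  by exists (gmul h a); [exact: subM|rewrite (rhoM cc) hs].
exists (gmul h (ginv a)); first by apply: subM => //; exact: subV.
by rewrite (rhoM cc) (rhoV cc) hs mulKg.
Qed.

Let avgN h : H h -> avg h *+ N = \sum_(s in img) pact s (pi (gexp G h N)).
Proof. by move=> Hh; rewrite -(hom_onX sH avgM). Qed.

(** This is the average of h^N, which acts trivially, and the lattice is stable under the action of
    [H]. *)
Let avg_lat h : H h -> B (avg h *+ N).
Proof.
move=> Hh; rewrite avgN //; elim/big_ind: _.
- exact: zsub0.
- by move=> a b; exact: zsubD.
- by move=> s /imgP[g Hg <-]; apply: pact_lattice => //; exact: latX.
Qed.

(** Put chi h = L (N avg h). On [P] all summands are nonnegative by [pact_ge0]; at the element c
    with pi c = u the summand of the identity is N, whence strict positivity. *)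
Lemma averaged_hom : exists chi : G -> R,
  [/\ hom_on H chi, forall h, P h -> 0 <= chi h & exists2 h, P h & 0 < chi h].
Proof.
exists (fun h => L (avg h *+ N)); split.
- by move=> a b Ha Hb; rewrite avgM // mulrnDl LD //; exact: avg_lat.
- move=> h Ph; have Hh := cone_sub cP Ph; rewrite avgN //.
  suff [] : B (\sum_(s in img) pact s (pi (gexp G h N))) /\
      0 <= L (\sum_(s in img) pact s (pi (gexp G h N))) by [].
  elim/big_ind: _.
  + by split; [exact: zsub0|rewrite (additive_on0 sB LD)].
  + move=> a b [Ba a0] [Bb b0]; split; first exact: zsubD.
    by rewrite LD // addr_ge0.
  + move=> s /imgP[g Hg <-]; split.
      by apply: pact_lattice => //; exact: latX.
    apply: pact_ge0 => //; first exact: latX.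
    apply: L_ge0; exists (gexp G h N); split=> //; last exact: (rhoX_card cc).
    by rewrite -(prednK N_gt0); exact: coneX cP Ph.
- have [c [Hc rc cu]] := Bu.
  have Pc : P c.
    by apply: latticeP_inv => //; apply: L_gt0; rewrite cu ?Lu // ltr01.
  exists c => //; rewrite avgN // (bigD1 1%g) /=; last first.
    by apply/imgP; exists gone; [exact: sub1|exact: rho1 cc].
  have E : pi (gexp G c N) = u *+ N by rewrite (pi_trivX cc) // cu.
  have BuN := zsub_muln sB N Bu.
  have LuN : L (u *+ N) = N%:R by rewrite (additive_onMn sB LD) // Lu.
  have [Br r0] : B (\sum_(s in img | s != 1%g) pact s (pi (gexp G c N))) /\
      0 <= L (\sum_(s in img | s != 1%g) pact s (pi (gexp G c N))).
    elim/big_ind: _.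
    + by split; [exact: zsub0|rewrite (additive_on0 sB LD)].
    + move=> a b [Ba a0] [Bb b0]; split; first exact: zsubD.
      by rewrite LD // addr_ge0.
    + move=> s /andP[/imgP[g Hg <-] _]; split.
        by rewrite E; exact: pact_lattice.
      by apply: pact_ge0; rewrite ?E // LuN ler0n.
  rewrite pact1 {1}E LD // LuN ltr_pwDl // ltr0n.
  exact: N_gt0.
Qed.

End Functional.

Lemma order_hom : exists chi : G -> R,
  [/\ hom_on H chi, forall h, P h -> 0 <= chi h & exists2 h, P h & 0 < chi h].
Proof.
have exQ : exists b, Q b.
  have [h Ph] := P_neq0; exists (pi (gexp G h N)), (gexp G h N); split=> //.
    by rewrite -(prednK N_gt0); exact: coneX cP Ph.
  exact: (rhoX_card cc).
have [u Qu cof] := cofinal_ex sB cQ exQ.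
have [L [LD L0 Lu]] := hoelder R sB cQ Qu cof.
exact: (averaged_hom LD L0 (zcone_sub cQ Qu) Lu).
Qed.

End Cone.
End OrderHom.

(** * Perturbing a left order *)

(** The finite lists [F] play the role of basic neighbourhoods of [P]; an element of reversed sign
    shows that the new cone is different. *)
Definition nonisolated (G : group) (H P : set G) :=
  forall F : seq G, (forall f, List.In f F -> P f) ->
  exists P', [/\ cone H P', forall f, List.In f F -> P' f &
              exists2 h, P h & P' (ginv h)].

Section Convex.
Variables (G : group) (H P : set G).
Hypothesis cP : cone H P.

(** The order is changed only on the convex subgroup [C], and the signs outside [C] are kept. *)
Lemma nonisolated_convex (C : set G) : is_subgroup C -> C `<=` H ->
  (forall p c, P p -> ~ C p -> C c -> P (gmul p c) /\ P (gmul c p)) ->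
  nonisolated C (C `&` P) -> nonisolated H P.
Proof.
move=> sC CH conv ni F PF.
have [|Pc [cPc PcF [h [Ch Ph] Pch]]] := ni (List.filter (fun f => `[< C f >]) F).
  by move=> f /List.filter_In[/PF Pf /asboolP Cf].
exists [set g | (P g /\ ~ C g) \/ Pc g]; split; last 2 first.
- move=> f Ff; have [Cf|nCf] := pselect (C f).
    by right; apply: PcF; apply/List.filter_In; split=> //; exact/asboolP.
  by left; split=> //; exact: PF.
- by exists h => //; right.
have nCM p c : ~ C p -> C c -> ~ C (gmul p c) /\ ~ C (gmul c p).
  move=> nCp Cc; split=> CM; apply: nCp.
    by rewrite -[p]gmulr1 -(gmulVr c) gmulA; apply: subM => //; exact: subV.
  by rewrite -(gmulK c p); apply: subM => //; exact: subV.
split.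
- by move=> a [[/(cone_sub cP)]|/(cone_sub cPc)/CH].
- by move=> [[_]|]; [case; exact: sub1|exact: (cone1 cPc)].
- move=> a b [[Pa nCa]|Pa] [[Pb nCb]|Pb].
  + left; split; first exact: (coneM cP).
    (* If ab lay in [C], then b (ab)^-1 = a^-1 would be positive. *)
    move=> Cab; have [Pab _] := conv _ _ Pb nCb (subV sC Cab).
    by apply: (cone_asym cP Pa); move: Pab; rewrite ginvM gmulKV.
  + have Cb := cone_sub cPc Pb; left.
    by split; [case: (conv a b)|case: (nCM a b)].
  + have Ca := cone_sub cPc Pa; left.
    by split; [case: (conv b a)|case: (nCM b a)].
  + by right; exact: (coneM cPc).
- move=> a Ha; have [Ca|nCa] := pselect (C a).
    case: (cone_total cPc Ca) => [->|Pa|Pa].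
    + by constructor 1.
    + by constructor 2; right.
    + by constructor 3; right.
  case: (cone_total cP Ha) => [->|Pa|Pa].
  + by constructor 1.
  + by constructor 2; left.
  + constructor 3; left; split=> // /(subV sC).
    by rewrite ginvK.
Qed.

End Convex.

Section Perturbation.
Variables (R : realType) (G : group) (H P : set G) (chi : G -> R).
Hypotheses (sH : is_subgroup H) (cP : cone H P).
Hypotheses (hchi : hom_on H chi) (chi_ge0 : forall h, P h -> 0 <= chi h).

Lemma order_hom_pos h : H h -> 0 < chi h -> P h.
Proof.
move=> Hh h0; case: (cone_total cP Hh) => [h1|//|/chi_ge0].
  by move: h0; rewrite h1 (hom_on1 sH hchi) ltxx.
by rewrite (hom_onV sH hchi) // oppr_ge0 leNgt h0.
Qed.

Lemma order_hom_convex (C := [set h | H h /\ chi h = 0]) p c :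
  P p -> ~ C p -> C c -> P (gmul p c) /\ P (gmul c p).
Proof.
move=> Pp nCp [Hc c0]; have Hp := cone_sub cP Pp.
have p0 : 0 < chi p.
  rewrite lt_neqAle chi_ge0 // andbT; apply/eqP => p0; apply: nCp.
  by split.
split; apply: order_hom_pos; try exact: subM.
  by rewrite hchi // c0 addr0.
by rewrite hchi // c0 add0r.
Qed.

(** The new order is led by M chi + psi, with ties decided by [P]. A large M keeps the elements of
    [F] with chi > 0 positive, and [compat] takes care of those with chi = 0. *)
Lemma nonisolated_perturb (psi : G -> int) k y :
  hom_on H psi -> H k -> psi k = 0 -> chi k != 0 -> H y -> psi y != 0 ->
  (forall c, P c -> chi c = 0 -> 0 <= psi c) -> nonisolated H P.
Proof.
move=> hpsi Hk k0 chik Hy y0 compat F PF.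
have [M HM] : exists M : nat, forall f, List.In f F -> 0 < chi f ->
    0 < M%:R * chi f + (psi f)%:~R.
  (* Asking for all larger M lets the bounds for the single elements of [F] be combined. *)
  have [M HM] : exists M0 : nat, forall M, (M0 <= M)%N -> forall f,
      List.In f F -> 0 < chi f -> 0 < M%:R * chi f + (psi f)%:~R.
    elim: F {PF} => [|f F [M0 IH]]; first by exists 0%N.
    have [f0|f0] := ltP 0 (chi f); last first.
      exists M0 => M MM f' [<-|]; last exact: IH.
      by rewrite ltNge f0.
    have c0 : 0 <= `|(psi f)%:~R| / chi f by rewrite divr_ge0 // ltW.
    have := archi_boundP c0; set m := Num.bound _.
    rewrite ltr_pdivrMr // => mf.
    exists (maxn M0 m) => M; rewrite geq_max => /andP[MM mM] f' [<- _|]; last exact: IH.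
    have : m%:R * chi f <= M%:R * chi f by rewrite ler_pM2r // ler_nat.
    have : - `|(psi f)%:~R| <= (psi f)%:~R :> R by rewrite lerNnormlW.
    lra.
  by exists M; exact: HM.
pose chi' h := M%:R * chi h + (psi h)%:~R.
have hchi' : hom_on H chi'.
  by move=> a b Ha Hb; rewrite /chi' hchi // hpsi // intrD mulrDr addrACA.
exists [set h | H h /\ (0 < chi' h \/ (chi' h = 0 /\ P h))]; split.
- split.
  + by move=> a [].
  + move=> [_ [|[_]]]; last exact: (cone1 cP).
    by rewrite (hom_on1 sH hchi') ltxx.
  + move=> a b [Ha Pa] [Hb Pb]; split; first exact: subM.
    rewrite hchi' //; case: Pa Pb => [a0|[-> Pa]] [b0|[-> Pb]].
    * by left; rewrite addr_gt0.
    * by left; rewrite addr0.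
    * by left; rewrite add0r.
    * by right; rewrite addr0; split=> //; exact: (coneM cP).
  + move=> a Ha; have HaV := subV sH Ha.
    have [a0|a0|a0] := ltgtP 0 (chi' a).
    * by constructor 2; split=> //; left.
    * by constructor 3; split=> //; left; rewrite (hom_onV sH hchi') // oppr_gt0.
    * case: (cone_total cP Ha) => [->|Pa|Pa].
      - by constructor 1.
      - by constructor 2; split=> //; right.
      - constructor 3; split=> //; right; split=> //.
        by rewrite (hom_onV sH hchi') // -a0 oppr0.
- move=> f Ff; have Pf := PF f Ff; split; first exact: (cone_sub cP).
  have := chi_ge0 Pf; rewrite le_eqVlt => /orP[/eqP f0|f0]; last by left; exact: HM.
  have := compat _ Pf (esym f0); rewrite le_eqVlt /chi' -f0 mulr0 add0r.
  move=> /orP[/eqP <-|p0]; first by right.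
  by left; rewrite ltr0z.
wlog k_gt0 : k Hk k0 chik / 0 < chi k.
  move=> wl; have [?|neg|E] := ltgtP 0 (chi k); first exact: (wl k).
    apply: (wl (ginv k)); first exact: subV.
    - by rewrite (hom_onV sH hpsi) // k0 oppr0.
    - by rewrite (hom_onV sH hchi) // oppr_eq0.
    - by rewrite (hom_onV sH hchi) // oppr_gt0.
  by move: chik; rewrite -E eqxx.
wlog y_lt0 : y Hy y0 / psi y < 0.
  move=> wl; have [?|pos|E] := ltgtP (psi y) 0; first exact: (wl y).
    apply: (wl (ginv y)); first exact: subV.
    - by rewrite (hom_onV sH hpsi) // oppr_eq0.
    - by rewrite (hom_onV sH hpsi) // oppr_lt0.
  by move: y0; rewrite E eqxx.
(* The element of reversed sign is h = y^a k^b: the exponent a is chosen with psi h <= -a < -M chi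
   k, and b with 0 < chi h <= chi k. *)
have c0 : 0 <= M%:R * chi k by rewrite mulr_ge0 // ltW.
have := archi_boundP c0; set a := Num.bound _ => aM.
pose t := (chi y *+ a) / chi k.
pose b : int := Num.floor (- t) + 1.
pose h := gmul (gexp G y a) (gzexp k b).
have Hya : H (gexp G y a) by exact: subX.
have Hkb : H (gzexp k b) by exact: subZ.
have Hh : H h by exact: subM.
have chih : chi h = (t + b%:~R) * chi k.
  rewrite /h hchi // (hom_onX sH hchi) // (hom_onZ sH hchi) //.
  by rewrite mulrDl divfK ?gt_eqF // -mulrzl.
have psih : psi h = psi y *+ a.
  rewrite /h hpsi // (hom_onX sH hpsi) // (hom_onZ sH hpsi) //.
  by rewrite k0 mul0rz addr0.
have [tb1 tb2] : 0 < t + b%:~R /\ t + b%:~R <= 1.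
  have /andP[f1 f2] := floor_itv (- t).
  by move: f1 f2; rewrite /b !intrD; lra.
have Ph : P h by apply: order_hom_pos => //; rewrite chih mulr_gt0.
exists h => //; split; first exact: subV.
left; rewrite (hom_onV sH hchi') // oppr_gt0 /chi' psih.
have chih_le : chi h <= chi k.
  by rewrite chih -[leRHS]mul1r ler_pM2r.
have : M%:R * chi h <= M%:R * chi k by rewrite ler_wpM2l.
have : (psi y *+ a)%:~R <= - a%:R :> R.
  rewrite -[a%:R]/((a%:Z)%:~R) -intrN ler_int -mulr_natr natz.
  by have : psi y <= -1 by [lia]; nia.
lra.
Qed.

End Perturbation.

(** * Non-isolated orders by induction on the rank *)

Section NonIsolated.
Variables (R : realType) (G : group) (X : finType).
Variables (rho : G -> {perm X}) (pi : G -> {ffun X -> int}).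
Hypothesis cc : cocycle rho pi.
Hypothesis pi_eq0 : forall g, pi g = 0 -> g = gone.

Definition grank (H : set G) := #|pivots (lattice rho pi H)|.

(** With equal pivots, [pivots_commensurable] would put a nonzero power of [w] into the kernel,
    forcing chi w = 0. *)
Lemma ker_grank_lt (H : set G) (chi : G -> R) w : is_subgroup H ->
  hom_on H chi -> H w -> chi w != 0 ->
  (grank [set h | H h /\ chi h = 0%R] < grank H)%N.
Proof.
move=> sH hchi Hw w0; set C := [set h | _].
have sC : is_subgroup C by exact: ker_subgroup.
have CB : lattice rho pi C `<=` lattice rho pi H.
  by move=> v [h [[Hh _] rh <-]]; exists h.
apply: proper_card; rewrite properE pivots_sub //=; apply/negP => piv.
pose N := #|{perm X}|; pose w' := gexp G w N.
have Hw' : H w' by exact: subX.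
have rw' : rho w' = 1%g by exact: rhoX_card cc _.
have [|z z0 [c [[Hc c0] rc cE]]] := pivots_commensurable
    (lattice_subgroup cc sH) (lattice_subgroup cc sC) CB piv (b := pi w').
  by exists w'.
have : c = gzexp w' z.
  apply: (pi_inj cc pi_eq0); rewrite cE; case: (z) => n /=.
    by rewrite (pi_trivX cc).
  rewrite -gexpS (pi_trivV cc); last by rewrite (rhoX cc) rw' expg1n.
  by rewrite (pi_trivX cc) // NegzE mulrNz -pmulrn.
move=> cz; move: c0; rewrite cz (hom_onZ sH hchi) // (hom_onX sH hchi) //.
move/eqP; rewrite -mulrzr mulf_eq0 intr_eq0 (negbTE z0) orbF.
rewrite -mulr_natr mulf_eq0 (negbTE w0) pnatr_eq0 /= -leqn0 leqNgt.
by move/negP; apply; apply/card_gt0P; exists 1%g.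
Qed.

Lemma cone_neq0 (H P : set G) h : cone H P -> H h -> h <> gone ->
  exists p, P p.
Proof.
by move=> cP Hh h1; case: (cone_total cP Hh) => // Ph; eexists; exact: Ph.
Qed.

(** On C = ker chi, the order homomorphism [chiC] of the restricted order is either independent of
    [psi], and the induction applies to the convex subgroup C of smaller rank, or proportional to
    it. In the latter case [psi] or its negative is nonnegative on the positive part of C, and
    [nonisolated_perturb] applies, as it does when [psi] vanishes on C. *)
Lemma nonisolated_hom (H P : set G) (chi : G -> R) (psi : G -> int) k y :
  is_subgroup H -> cone H P -> hom_on H chi -> (forall h, P h -> 0 <= chi h) ->
  hom_on H psi -> H y -> psi y != 0 -> H k -> psi k = 0 -> chi k != 0 ->
  nonisolated H P.
Proof.
move: {2}(grank H).+1 (ltnSn (grank H)) => n.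
elim: n H P chi psi k y => // n IH H P chi psi k y rkH sH cP hchi chi0 hpsi.
move=> Hy y0 Hk k0 chik.
pose C := [set h | H h /\ chi h = 0].
have sC : is_subgroup C by exact: ker_subgroup.
have CH : C `<=` H by move=> h [].
have [[c0 [Cc0 psic0]]|noC] := pselect (exists c, C c /\ psi c != 0); last first.
  apply: (nonisolated_perturb sH cP hchi chi0 hpsi Hk k0 chik Hy y0).
  move=> c Pc chic; have -> // : psi c = 0.
  apply/eqP/negPn/negP => psic; apply: noC; exists c; split=> //.
  by split=> //; exact: (cone_sub cP).
have cPC : cone C (C `&` P) by exact: cone_restrict cP.
have c01 : c0 <> gone.
  by move=> E; move: psic0; rewrite E (hom_on1 sH hpsi) eqxx.
have [chiC [hchiC chiC0 [p [Cp Pp] p0]]] :=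
  order_hom R cc pi_eq0 sC cPC (cone_neq0 cPC Cc0 c01).
have hpsiC := hom_onS CH hpsi.
have [[k' [Ck' k'0 chik']]|dep] :=
    pselect (exists k', [/\ C k', psi k' = 0 & chiC k' != 0]).
  apply: (nonisolated_convex cP sC CH).
    by move=> q c; exact: (order_hom_convex sH cP hchi chi0).
  apply: (IH C _ chiC psi k' c0) => //.
  exact: (leq_trans (ker_grank_lt sH hchi Hk chik) rkH).
(* The element c^(psi p) p^(-psi c) lies in ker psi, hence by [dep] in ker chiC. *)
have prop c : C c -> chiC c * (psi p)%:~R = chiC p * (psi c)%:~R.
  move=> Cc.
  have Ck' : C (gmul (gzexp c (psi p)) (gzexp p (- psi c))).
    by apply: (subM sC); exact: subZ.
  apply/eqP; rewrite -subr_eq0; apply/negPn/negP => neq; apply: dep.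
  exists (gmul (gzexp c (psi p)) (gzexp p (- psi c))); split=> //.
    rewrite hpsiC; [|exact: subZ|exact: subZ].
    by rewrite !(hom_onZ sC hpsiC) // !mulrzz mulrN mulrC subrr.
  rewrite hchiC; [|exact: subZ|exact: subZ].
  by rewrite !(hom_onZ sC hchiC) // mulrNz -[chiC c *~ _]mulrzr -[chiC p *~ _]mulrzr.
have psip : psi p != 0.
  apply/eqP => psip; apply: dep; exists p; split=> //.
  by rewrite gt_eqF.
have [psip_gt0|psip_lt0|E] := ltgtP 0 (psi p); last by rewrite -E eqxx in psip.
  apply: (nonisolated_perturb sH cP hchi chi0 hpsi Hk k0 chik Hy y0).
  move=> c Pc chic; have Cc : C c by split=> //; exact: (cone_sub cP).
  have := prop c Cc; have := chiC0 c (conj Cc Pc) => c_ge0 E.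
  rewrite -(ler0z R) -(pmulr_rge0 _ p0) -E mulr_ge0 // ler0z ltW //.
have hpsiN : hom_on H (fun g => - psi g).
  by move=> a b Ha Hb; rewrite hpsi // opprD.
apply: (nonisolated_perturb sH cP hchi chi0 hpsiN Hk _ chik Hy).
- by rewrite k0 oppr0.
- by rewrite oppr_eq0.
move=> c Pc chic; have Cc : C c by split=> //; exact: (cone_sub cP).
have := prop c Cc; have := chiC0 c (conj Cc Pc) => c_ge0 E.
rewrite oppr_ge0 -(lerz0 R) -(pmulr_rle0 _ p0) -E mulr_ge0_le0 // lerz0 ltW //.
Qed.

Lemma nonisolated_two_homs (H P : set G) (phi1 phi2 : G -> int) a b :
  is_subgroup H -> cone H P -> hom_on H phi1 -> hom_on H phi2 ->
  H a -> H b -> phi1 a * phi2 b != phi1 b * phi2 a -> nonisolated H P.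
Proof.
move=> sH cP h1 h2 Ha Hb det.
have exP : exists p, P p.
  have a1 : a <> gone.
    by move=> E; move: det; rewrite E (hom_on1 sH h1) (hom_on1 sH h2) mulr0 mul0r eqxx.
  exact: (cone_neq0 cP Ha a1).
have [chi [hchi chi0 [k Pk k_gt0]]] := order_hom R cc pi_eq0 sH cP exP.
have Hk := cone_sub cP Pk; have chik : chi k != 0 by rewrite gt_eqF.
have [/andP[/eqP k1 /eqP k2]|kn0] := boolP ((phi1 k == 0) && (phi2 k == 0)).
  have [a1|a1] := eqVneq (phi1 a) 0; last first.
    exact: (nonisolated_hom sH cP hchi chi0 h1 Ha a1 Hk k1 chik).
  have b1 : phi1 b != 0.
    by apply/eqP => b1; move: det; rewrite a1 b1 !mul0r eqxx.
  exact: (nonisolated_hom sH cP hchi chi0 h1 Hb b1 Hk k1 chik).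
(* This combination vanishes at [k]; by Cramer's rule it is nonzero at [a] or at [b], because phi1 k
   and phi2 k are not both 0. *)
pose psi g := phi1 k * phi2 g - phi2 k * phi1 g.
have hpsi : hom_on H psi.
  by move=> c e Hc He; rewrite /psi h1 // h2 //; ring.
have psik : psi k = 0 by rewrite /psi mulrC subrr.
have [a0|a0] := eqVneq (psi a) 0; last first.
  exact: (nonisolated_hom sH cP hchi chi0 hpsi Ha a0 Hk psik chik).
have [b0|b0] := eqVneq (psi b) 0; last first.
  exact: (nonisolated_hom sH cP hchi chi0 hpsi Hb b0 Hk psik chik).
case/negP: kn0; move: det a0 b0; rewrite /psi -subr_eq0.
set d := _ - _ => d0 a0 b0.
have E1 : phi1 k * d = 0.
  have -> : phi1 k * d = phi1 a * (phi1 k * phi2 b - phi2 k * phi1 b)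
     - phi1 b * (phi1 k * phi2 a - phi2 k * phi1 a) by rewrite /d; ring.
  by rewrite a0 b0 !mulr0 subrr.
have E2 : phi2 k * d = 0.
  have -> : phi2 k * d = phi2 a * (phi1 k * phi2 b - phi2 k * phi1 b)
     - phi2 b * (phi1 k * phi2 a - phi2 k * phi1 a) by rewrite /d; ring.
  by rewrite a0 b0 !mulr0 subrr.
by move: E1 E2 => /eqP + /eqP; rewrite !mulf_eq0 (negbTE d0) !orbF => -> ->.
Qed.

(* Descend along the kernels of the order homomorphisms as long as they see
   the rank two part of [K]; when this stops, [H/(H ∩ K)] or [K ∩ H] supplies
   a homomorphism independent of the one given by the order. *)
Lemma nonisolated_rank2 (K : set G) (phi1 phi2 : G -> int) :
  hom_on K phi1 -> hom_on K phi2 ->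
  (forall H : set G, is_subgroup H -> ~ (H `<=` K) ->
     exists psi : G -> int, [/\ hom_on H psi, forall h, H h -> K h -> psi h = 0 &
       exists2 h, H h & psi h != 0]) ->
  forall (H P : set G) a b, is_subgroup H -> cone H P ->
  H a -> K a -> H b -> K b -> phi1 a * phi2 b != phi1 b * phi2 a ->
  nonisolated H P.
Proof.
move=> h1 h2 ind H P a b.
move: {2}(grank H).+1 (ltnSn (grank H)) => n.
elim: n H P a b => // n IH H P a b rkH sH cP Ha Ka Hb Kb det.
have [HK|nHK] := pselect (H `<=` K).
  exact: (nonisolated_two_homs sH cP (hom_onS HK h1) (hom_onS HK h2) Ha Hb det).
have [psi [hpsi psiK [y Hy y0]]] := ind H sH nHK.
have y1 : y <> gone by move=> E; move: y0; rewrite E (hom_on1 sH hpsi) eqxx.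
have [chi [hchi chi0 [p Pp p_gt0]]] :=
  order_hom R cc pi_eq0 sH cP (cone_neq0 cP Hy y1).
have Hp := cone_sub cP Pp; have chip : chi p != 0 by rewrite gt_eqF.
have [a0|a0] := eqVneq (chi a) 0; last first.
  exact: (nonisolated_hom sH cP hchi chi0 hpsi Hy y0 Ha (psiK _ Ha Ka) a0).
have [b0|b0] := eqVneq (chi b) 0; last first.
  exact: (nonisolated_hom sH cP hchi chi0 hpsi Hy y0 Hb (psiK _ Hb Kb) b0).
pose C := [set h | H h /\ chi h = 0].
have sC : is_subgroup C by exact: ker_subgroup.
have CH : C `<=` H by move=> h [].
apply: (nonisolated_convex cP sC CH).
  by move=> q c; exact: (order_hom_convex sH cP hchi chi0).
apply: (IH C _ a b) => //; last exact: cone_restrict cP.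
exact: (leq_trans (ker_grank_lt sH hchi Hp chip) rkH).
Qed.

(** On the subgroup generated by [a] and [b], an order homomorphism takes the value chi a + chi b at
    b^-1 a b^2. If that were 0, chi would vanish on both generators, hence everywhere. *)
Lemma order_conradian (P : set G) a b : cone setT P -> P a -> P b ->
  P (gmul (ginv b) (gmul a (gexp G b 2))).
Proof.
move=> cP Pa Pb.
pose H := [set g | forall K, is_subgroup K -> K a -> K b -> K g].
have sH : is_subgroup H.
  split.
  - by move=> K sK _ _; exact: (sub1 sK).
  - by move=> g h Hg Hh K sK Ka Kb; apply: (subM sK); [exact: (Hg K)|exact: (Hh K)].
  - by move=> g Hg K sK Ka Kb; apply: (subV sK); exact: (Hg K).
have Ha : H a by []. have Hb : H b by [].
have cPH : cone H (H `&` P) by exact: cone_restrict cP.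
have [chi [hchi chi0 [p [Hp Pp] p_gt0]]] :=
  order_hom R cc pi_eq0 sH cPH (ex_intro _ a (conj Ha Pa)).
have HbV := subV sH Hb; have Hb2 := subX 2 sH Hb.
have Hab2 := subM sH Ha Hb2; have Hc := subM sH HbV Hab2.
have E : chi (gmul (ginv b) (gmul a (gexp G b 2))) = chi a + chi b.
  rewrite (hchi _ _ HbV Hab2) (hchi _ _ Ha Hb2) (hom_onV sH hchi Hb).
  by rewrite (hom_onX sH hchi 2 Hb) mulr2n; ring.
have a_ge0 := chi0 _ (conj Ha Pa); have b_ge0 := chi0 _ (conj Hb Pb).
have [ab|ab] := ltP 0 (chi a + chi b).
  by have [] := order_hom_pos sH cPH hchi chi0 Hc; rewrite ?E.
have a0 : chi a = 0 by lra.
have b0 : chi b = 0 by lra.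
have [_ p0] := Hp _ (ker_subgroup sH hchi) (conj Ha a0) (conj Hb b0).
by move: p_gt0; rewrite p0 ltxx.
Qed.

End NonIsolated.

(** * Set-theoretical solutions *)

Section SolutionTheory.
Variable s : solution.
Hypotheses (nd : non_degenerate s) (sym : symmetric_sol s).
Local Notation g := (sg s).
Local Notation f := (sf s).
Implicit Types x y z : scar s.

Lemma g_inj x : injective (g x). Proof. by apply: bij_inj; case: (nd x). Qed.
Lemma f_inj x : injective (f x). Proof. by apply: bij_inj; case: (nd x). Qed.

Lemma sol_invol x y : g (g x y) (f y x) = x.
Proof. by case: sym => /(_ (x, y)) []. Qed.

Lemma sol_gM x y z : g x (g y z) = g (g x y) (g (f y x) z).
Proof. by case: sym => _ /(_ (x, y, z)) []. Qed.

Lemma sol_fM x y z : f z (f y x) = f (f z y) (f (g y z) x).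
Proof. by case: sym => _ /(_ (x, y, z)) []. Qed.

Definition gperm x : {perm scar s} := perm (@g_inj x).

Definition gdiag x := (gperm x)^-1%g x.

Lemma gdiagK x : g x (gdiag x) = x.
Proof. by have := permKV (gperm x) x; rewrite permE. Qed.

(** Write T for [gdiag]. Since g_x (T x) = x, involutivity gives f_(T x) (x) = T x; so T x = T y
    makes x and y have the same image under f_(T x). *)
Lemma gdiag_inj : injective gdiag.
Proof.
have fix_f x z : g x z = x -> f z x = z.
  by move=> xz; apply: (@g_inj x); have := sol_invol x z; rewrite xz => ->.
move=> x y E; apply: (@f_inj (gdiag x)).
by rewrite (fix_f _ _ (gdiagK x)) E (fix_f _ _ (gdiagK y)).
Qed.

(** By the braid relation and involutivity, g_v sends both sides to v. Hence f_x = T^-1 g_x^-1 T for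
    T = [gdiag], so f_x determines g_x. *)
Lemma gdiag_f x v : g x (gdiag (f x v)) = gdiag v.
Proof.
by apply: (@g_inj v); rewrite sol_gM !gdiagK sol_invol.
Qed.

Lemma sf_eq_sg x y : f x =1 f y -> g x =1 g y.
Proof.
move=> E z.
have inj : injective (fun v => gdiag (f x v)).
  by move=> v w /gdiag_inj/f_inj.
have <- : gdiag (f x (invF inj z)) = z by exact: (f_invF inj z).
by rewrite gdiag_f E gdiag_f.
Qed.

Lemma ret_relP x y : reflect (f x =1 f y) (ret_rel x y).
Proof. by apply: (iffP forallP) => H z; apply/eqP/H. Qed.

Lemma ret_clsP x y : ret_cls x = ret_cls y <-> f x =1 f y.
Proof.
have cE z : f (canon z) =1 f z by exact/ret_relP/ret_rel_canon.
split=> [E z|E].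
  by have /(congr1 val) /= E' := E; rewrite -cE E' cE.
apply: val_inj => /=; rewrite /canon.
have -> : [pick z | ret_rel z x] = [pick z | ret_rel z y].
  apply: eq_pick => z; apply/ret_relP/ret_relP => H w; first by rewrite H E.
  by rewrite H -E.
case: pickP => //= /(_ y); rewrite (_ : ret_rel y y) //.
exact/ret_relP.
Qed.

Lemma ret_cls_val (a : ret_car s) : ret_cls (val a) = a.
Proof. by apply: val_inj; apply/eqP/(valP a). Qed.

Lemma canon_f x : f (canon x) =1 f x.
Proof. exact/ret_relP/ret_rel_canon. Qed.

(** The relation f_y f_x = f_(f_y x) f_(g_x y) shows that f_(g_x y) does not change when y is
    replaced by an equivalent point; for x, [sf_eq_sg] suffices. *)
Lemma ret_cls_g x y : ret_cls (g x y) = sg (retract s) (ret_cls x) (ret_cls y).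
Proof.
apply/ret_clsP => w /=.
rewrite (sf_eq_sg (canon_f x)).
suff E : f (f y x) (f (g x y) w) = f (f (canon y) x) (f (g x (canon y)) w).
  by move: E; rewrite canon_f => /f_inj.
by rewrite -!sol_fM canon_f.
Qed.

Lemma ret_cls_f x y : ret_cls (f y x) = sf (retract s) (ret_cls y) (ret_cls x).
Proof.
apply/ret_clsP => w /=; rewrite canon_f.
have [fV _ K2] : bijective (f (g x y)) by case: (nd (g x y)).
have w1 := K2 w.
have w2 : f (g (canon x) y) (fV w) = w by rewrite (sf_eq_sg (canon_f x)).
by rewrite -[in LHS]w1 -[in RHS]w2 -!sol_fM canon_f.
Qed.

End SolutionTheory.

Lemma surj_bijective (T : finType) (h : T -> T) :
  (forall y, exists x, h x = y) -> bijective h.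
Proof.
move=> H; have H' y : exists x, h x == y by have [x <-] := H y; exists x.
pose k y := xchoose (H' y).
have kK : cancel k h by move=> y; apply/eqP; exact: (xchooseP (H' y)).
exact: (bij_can_bij (injF_bij (can_inj kK)) kK).
Qed.

Section Image.
Variables (s t : solution) (q : scar s -> scar t).
Hypothesis q_surj : forall a, exists x, q x = a.
Hypothesis q_g : forall x y, q (sg s x y) = sg t (q x) (q y).
Hypothesis q_f : forall x y, q (sf s y x) = sf t (q y) (q x).

Lemma image_non_degenerate : non_degenerate s -> non_degenerate t.
Proof.
move=> nd a; have [x <-] := q_surj a; have [[fV _ fK] [gV _ gK]] := nd x.
split; apply: surj_bijective => b; have [y <-] := q_surj b.
  by exists (q (fV y)); rewrite -q_f fK.
by exists (q (gV y)); rewrite -q_g gK.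
Qed.

Lemma image_symmetric : symmetric_sol s -> symmetric_sol t.
Proof.
move=> [inv ybe]; split.
  move=> [a b]; have [x <-] := q_surj a; have [y <-] := q_surj b.
  by have := inv (x, y); rewrite /solS /= -!(q_g, q_f) => -[-> ->].
move=> [[a b] c]; have [x <-] := q_surj a; have [y <-] := q_surj b.
have [z <-] := q_surj c; have := ybe (x, y, z).
by rewrite /S12 /S23 /solS /= -!(q_g, q_f) => -[-> -> ->].
Qed.

End Image.

(** * Maps on a group that factor through a cocycle *)

Section CommutingAction.
Variables (Y : finType) (W : Type) (alpha beta : Y -> W -> W).
Hypothesis alphaK : forall y w, beta y (alpha y w) = w.
Hypothesis betaK : forall y w, alpha y (beta y w) = w.
Hypothesis alphaC : forall y z w, alpha y (alpha z w) = alpha z (alpha y w).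

Definition evec (y : Y) : {ffun Y -> int} := [ffun z => (z == y)%:Z].

Let zpow y (z : int) w :=
  match z with Posz n => iter n (alpha y) w | Negz n => iter n.+1 (beta y) w end.

Let zpowS y z w : zpow y (z + 1) w = alpha y (zpow y z w).
Proof.
case: z => [n|[|n]]; rewrite ?NegzE.
- by have -> : n%:Z + 1 = n.+1%:Z by lia.
- by rewrite addNr /= betaK.
- have -> : - n.+2%:Z + 1 = Negz n by lia.
  by rewrite -NegzE /= betaK.
Qed.

Let zpowC y y' z w : zpow y z (alpha y' w) = alpha y' (zpow y z w).
Proof.
case: z => n /=; first by elim: n => //= n ->; rewrite alphaC.
have C w' : beta y (alpha y' w') = alpha y' (beta y w').
  by rewrite -{1}[w'](betaK y) alphaC alphaK.
rewrite -!iterS; elim: n.+1 => //= k ->; exact: C.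
Qed.

Let actl (r : seq Y) (v : {ffun Y -> int}) w :=
  foldr (fun y w => zpow y (v y) w) w r.

Let actlS r v y w : uniq r -> actl r (v + evec y) w =
  if y \in r then alpha y (actl r v w) else actl r v w.
Proof.
elim: r => //= z r IH /andP[zr ur]; rewrite !ffunE IH // in_cons eq_sym.
have [E|zy] := eqVneq z y; first by subst z; rewrite (negbTE zr) /= zpowS.
rewrite /= addr0; case: (y \in r) => //; exact: zpowC.
Qed.

Let act v w := actl (enum Y) v w.

Let actS v y w : act (v + evec y) w = alpha y (act v w).
Proof. by rewrite /act actlS ?enum_uniq // mem_enum. Qed.

Let act0 w : act 0 w = w.
Proof. by rewrite /act; elim: (enum Y) => //= y r ->; rewrite ffunE. Qed.

(** The commuting bijections alpha_y make Z^Y act on [W]. A generator on the right moves [F] by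
    alpha_y and [pi] by e_y with the same y, so F a is the vector pi a acting on F 1. *)
Lemma factor_through_vector (G : group) (X : Type) (iota : X -> G)
    (F : G -> W) (pi : G -> {ffun Y -> int}) :
  (forall P : G -> Prop, (forall x, P (iota x)) -> P gone ->
     (forall a b, P a -> P b -> P (gmul a b)) -> (forall a, P a -> P (ginv a)) ->
     forall h, P h) ->
  pi gone = 0 ->
  (forall a x, exists y, F (gmul a (iota x)) = alpha y (F a) /\
                         pi (gmul a (iota x)) = pi a + evec y) ->
  forall a b, pi a = pi b -> F a = F b.
Proof.
move=> gen pi1 step.
suff H a : F a = act (pi a) (F gone) by move=> a b E; rewrite H E -H.
pose ok a := F a = act (pi a) (F gone).
(* An equivalence for all b passes to inverses in the induction over generators. *)
suff : forall b, ok b <-> ok (gmul b a).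
  move=> /(_ gone) [+ _]; rewrite gmul1; apply.
  by rewrite /ok pi1 act0.
move: a; apply: gen.
- move=> x b; rewrite /ok; have [y [-> ->]] := step b x; rewrite actS.
  by split=> [->//|/(congr1 (beta y))]; rewrite !alphaK.
- by move=> b; rewrite gmulr1.
- by move=> a b Ha Hb c; rewrite gmulA -Hb -Ha.
- by move=> a Ha b; rewrite (Ha (gmul b (ginv a))) -gmulA gmulV gmulr1.
Qed.

End CommutingAction.

Section StructureAction.
Variable t : solution.
Hypotheses (nd : non_degenerate t) (sym : symmetric_sol t).
Variables (W : group) (j : scar t -> W) (tau : W -> {perm scar t}).
Hypothesis jrel :
  forall x y, gmul (j x) (j y) = gmul (j (sg t x y)) (j (sf t y x)).
Hypothesis tauM : forall a b, tau (gmul a b) = (tau b * tau a)%g.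
Hypothesis tauj : forall x y, tau (j x) y = sg t x y.

(** The index is pulled back along [tau w] so that, for a cocycle over [tau], this step adds e_x
    whatever [w] is. *)
Definition salpha x (w : W) : W := gmul w (j ((tau w)^-1%g x)).

(** Multiplying [w] by the inverse of j z subtracts e at the point tau w (gdiag z); hence the
    inverse of [gdiag]. *)
Definition sbeta x (w : W) : W :=
  gmul w (ginv (j (invF (@gdiag_inj t nd sym) ((tau w)^-1%g x)))).

Let tau1 : tau gone = 1%g.
Proof. by apply: (mulgI (tau gone)); rewrite -tauM gmul1 mulg1. Qed.

Let tauV a : tau (ginv a) = (tau a)^-1%g.
Proof. by apply: (mulgI (tau a)); rewrite -tauM gmulV mulgV tau1. Qed.

Let taujE x : tau (j x) = gperm nd x.
Proof. by apply/permP => y; rewrite tauj permE. Qed.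

Lemma salphaK x w : sbeta x (salpha x w) = w.
Proof.
rewrite /sbeta /salpha; set y := (tau w)^-1%g x.
rewrite tauM invMg permM -/y taujE.
rewrite -/(gdiag nd y) invF_f -gmulA gmulVr gmulr1 //.
Qed.

Lemma sbetaK x w : salpha x (sbeta x w) = w.
Proof.
rewrite /sbeta /salpha; set y := invF _ _.
have Ty : gdiag nd y = (tau w)^-1%g x by exact: f_invF.
rewrite tauM invMg permM tauV invgK -Ty tauj gdiagK.
by rewrite -gmulA gmulV gmulr1.
Qed.

(** The two orders of the steps are the two sides of a relation of the structure group. *)
Lemma salphaC x y w : salpha x (salpha y w) = salpha y (salpha x w).
Proof.
rewrite /salpha !tauM !invMg !permM -!gmulA; congr (gmul w _).
set x' := (tau w)^-1%g x; set y' := (tau w)^-1%g y.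
set z := (tau (j y'))^-1%g x'.
have yz : sg t y' z = x' by rewrite -tauj permKV.
rewrite jrel yz; congr (gmul _ (j _)).
by apply: (@perm_inj _ (tau (j x'))); rewrite permKV tauj -yz sol_invol.
Qed.

End StructureAction.

(** * The cocycles of the retraction tower *)

Section Semidirect.
Variable Y : finType.
Let car := ({ffun Y -> int} * {perm Y})%type.
Let mul (a b : car) : car := (a.1 + pact a.2 b.1, (b.2 * a.2)%g).
Let inv (a : car) : car := (- pact a.2^-1%g a.1, a.2^-1%g).

Let mulA a b c : mul a (mul b c) = mul (mul a b) c.
Proof. by rewrite /mul /= pactD -pactM addrA mulgA. Qed.

Let mul1 a : mul (0, 1%g) a = a.
Proof. by case: a => v p; rewrite /mul /= add0r pact1 mulg1. Qed.

Let mulV a : mul (inv a) a = (0, 1%g).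
Proof. by rewrite /mul /= addNr mulgV. Qed.

Definition semidirect : group := Group mulA mul1 mulV.

Let pmul (a b : {perm Y}) : {perm Y} := (b * a)%g.
Let pmulA a b c : pmul a (pmul b c) = pmul (pmul a b) c.
Proof. by rewrite /pmul mulgA. Qed.
Let pmul1 a : pmul 1%g a = a. Proof. by rewrite /pmul mulg1. Qed.
Let pmulV a : pmul a^-1%g a = 1%g. Proof. by rewrite /pmul mulgV. Qed.

(* Composition order: [(gmul a b) y = a (b y)], opposite to MathComp's [a * b]. *)
Definition perm_group : group := Group pmulA pmul1 pmulV.

Lemma pact_evec (p : {perm Y}) y : pact p (evec y) = evec (p y).
Proof.
apply/ffunP => z; rewrite !ffunE; congr (nat_of_bool _)%:Z.
by rewrite -(inj_eq (@perm_inj _ p)) permKV.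
Qed.

Lemma evec_inj : injective (@evec Y).
Proof.
move=> y z /ffunP/(_ y); rewrite !ffunE eqxx.
by case: eqP.
Qed.

End Semidirect.

Record morphism (s t : solution) (c : scar s -> scar t) : Prop := Morphism {
  morph_g : forall x y, c (sg s x y) = sg t (c x) (c y);
  morph_f : forall x y, c (sf s y x) = sf t (c y) (c x) }.

Record level (s t : solution) (G : group) (iota : scar s -> G)
    (c : scar s -> scar t) (rho : G -> {perm scar t})
    (pi : G -> {ffun scar t -> int}) : Prop := Level {
  level_cc : cocycle rho pi;
  level_rho : forall x z, rho (iota x) z = sg t (c x) z;
  level_pi : forall x, pi (iota x) = evec (c x) }.

Section Levels.
Variables (s : solution) (G : group) (iota : scar s -> G).
Hypothesis sg_G : is_structure_group s G iota.

(** The relations hold in the semidirect product: by involutivity both sides have vector e_x +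
    e_(g_x y), with x and y read in [t], and by the braid relation equal permutations. *)
Lemma level_ex (t : solution) (c : scar s -> scar t) :
  non_degenerate t -> symmetric_sol t -> morphism c ->
  exists rho pi, level iota c rho pi.
Proof.
move=> nd sym mc; have [_ _ univ] := sg_G.
pose phi x : semidirect (scar t) := (evec (c x), gperm nd (c x)).
have rel x y : gmul (phi x) (phi y) = gmul (phi (sg s x y)) (phi (sf s y x)).
  rewrite /phi (morph_g mc) (morph_f mc) /=; congr pair.
    by rewrite !pact_evec !permE sol_invol // addrC.
  by apply/permP => z; rewrite !permM !permE sol_gM.
have [psi [psiM psi_iota]] := univ _ phi rel.
exists (fun g => (psi g).2), (fun g => (psi g).1); split.
- by split=> a b; rewrite psiM.
- by move=> x z; rewrite psi_iota permE.
- by move=> x; rewrite psi_iota.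
Qed.

Lemma level_step (t : solution) (c : scar s -> scar t) rho pi :
  level iota c rho pi -> forall a x,
  pi (gmul a (iota x)) = pi a + evec (rho a (c x)).
Proof.
by move=> lv a x; rewrite (piM (level_cc lv)) (level_pi lv) pact_evec.
Qed.

Let gen : forall P : G -> Prop, (forall x, P (iota x)) -> P gone ->
  (forall a b, P a -> P b -> P (gmul a b)) -> (forall a, P a -> P (ginv a)) ->
  forall h, P h.
Proof. by case: sg_G. Qed.

Lemma level0_inj rho pi : non_degenerate s -> symmetric_sol s ->
  level iota id rho pi -> forall a b, pi a = pi b -> a = b.
Proof.
move=> nd sym lv; have cc := level_cc lv.
have rel : forall x y, gmul (iota x) (iota y) =
  gmul (iota (sg s x y)) (iota (sf s y x)) by case: sg_G.
apply: (@factor_through_vector _ _ (salpha iota rho)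
  (sbeta nd sym iota rho) _ _ _ G _ iota id pi) => //.
- by move=> y w; apply: (salphaK nd sym (rhoM cc) (level_rho lv)).
- by move=> y w; apply: (sbetaK nd sym (rhoM cc) (level_rho lv)).
- by move=> y z w; apply: (salphaC sym rel (rhoM cc) (level_rho lv)).
- exact: (pi1 cc).
- move=> a x; exists (rho a x); split; last exact: (level_step lv).
  by rewrite /salpha permK.
Qed.

Section Retract.
Variables (t : solution) (c : scar s -> scar t).
Hypotheses (nd : non_degenerate t) (sym : symmetric_sol t).
Variables (rho : G -> {perm scar t}) (pi : G -> {ffun scar t -> int}).
Variables (rho' : G -> {perm scar (retract t)})
          (pi' : G -> {ffun scar (retract t) -> int}).
Let c' x : scar (retract t) := ret_cls (c x).
Hypothesis lv : level iota c rho pi.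
Hypothesis lv' : level iota c' rho' pi'.
Let cc := level_cc lv.
Let cc' := level_cc lv'.

Lemma level_compat a z : rho' a (ret_cls z) = ret_cls (rho a z).
Proof.
move: a z; apply: gen.
- by move=> x z; rewrite (level_rho lv) (level_rho lv') ret_cls_g.
- by move=> z; rewrite (rho1 cc) (rho1 cc') !perm1.
- by move=> a b Ha Hb z; rewrite (rhoM cc) (rhoM cc') !permM Hb Ha.
- move=> a Ha z; rewrite (rhoV cc) (rhoV cc').
  by apply: (@perm_inj _ (rho' a)); rewrite permKV Ha permKV.
Qed.

Lemma level_pi_retract a b : pi a = pi b -> pi' a = pi' b.
Proof.
pose e (y : scar t) : {ffun scar (retract t) -> int} := evec (ret_cls y).
apply: (@factor_through_vector _ _ (fun y w => w + e y) (fun y w => w - e y)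
  _ _ _ G _ iota pi' pi) => //.
- by move=> y w; rewrite addrK.
- by move=> y w; rewrite subrK.
- by move=> y z w; rewrite addrAC.
- exact: (pi1 cc).
- move=> g x; exists (rho g (c x)); split; last exact: (level_step lv).
  by rewrite (level_step lv') level_compat.
Qed.

(** As g_x depends only on the class of x, the steps of [rho] can be indexed by points of the
    retract, and then they match those of [pi']. *)
Lemma level_rho_retract a b : pi' a = pi' b -> rho a = rho b.
Proof.
have tj x y : gperm nd x y = sg t x y by rewrite permE.
pose j x : perm_group (scar t) := gperm nd x.
have rel x y : gmul (j x) (j y) = gmul (j (sg t x y)) (j (sf t y x)).
  by apply/permP => z; rewrite !permM !permE sol_gM.
have tM (p q : perm_group (scar t)) : (gmul p q : {perm _}) = (q * p)%g by [].
pose al (y : scar (retract t)) :=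
  @salpha t (perm_group (scar t)) (gperm nd) id (val y).
pose be (y : scar (retract t)) :=
  @sbeta t nd sym (perm_group (scar t)) (gperm nd) id (val y).
apply: (@factor_through_vector _ _ al be _ _ _ G _ iota rho pi') => //.
- by move=> y w; apply: (salphaK nd sym tM tj).
- by move=> y w; apply: (sbetaK nd sym tM tj).
- by move=> y z w; apply: (salphaC sym rel tM tj).
- exact: (pi1 cc').
- move=> g x; exists (rho' g (c' x)); split; last exact: (level_step lv').
  rewrite (rhoM cc) /al /salpha /=; congr (_ * _)%g.
  apply/permP => z; rewrite (level_rho lv) permE.
  apply: sf_eq_sg => //; apply/ret_clsP.
  apply: (@perm_inj _ (rho' g)); rewrite -/(c' x) level_compat permKV.
  by rewrite ret_cls_val.
Qed.

End Retract.
End Levels.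

Lemma int_mul_nat_eq1 (d : int) (n : nat) : d * n%:Z = 1 -> d = 1 /\ n = 1%N.
Proof.
case: n => [|[|n]]; rewrite ?mulr0 ?mulr1 // => E; exfalso.
by have [d0|d0] := lerP d 0; nia.
Qed.

(** The total degree is a homomorphism to Z with value 1 on the generators iota z. So each of these
    is c or c^-1, according to the degree of c alone; all of them coincide, and so do their cocycle
    values e_z. *)
Lemma cyclic_subsingleton (t : solution) (G : group) (iota : scar t -> G) :
  non_degenerate t -> symmetric_sol t -> is_structure_group t G iota ->
  cyclic_group G -> forall x y : scar t, x = y.
Proof.
move=> nd sym sG [c cyc] x y.
have mid : @morphism t t id by split.
have [rho [pi lv]] := level_ex sG nd sym mid; have cc := level_cc lv.
pose deg g := \sum_z pi g z.
have hdeg : hom_on setT deg.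
  move=> a b _ _; rewrite /deg (piM cc); under eq_bigr do rewrite !ffunE.
  rewrite big_split /=; congr (_ + _).
  by rewrite [RHS](reindex_inj (@perm_inj _ (rho a)^-1%g)).
have deg1 z : deg (iota z) = 1.
  rewrite /deg (level_pi lv) (bigD1 z) //= ffunE eqxx big1 ?addr0 //.
  by move=> w wz; rewrite ffunE (negbTE wz).
have key z : iota z = if deg c == 1 then c else ginv c.
  have [n [E|E]] := cyc (iota z); have := deg1 z; rewrite {1}E.
    rewrite (hom_onX subT hdeg) // -mulr_natr natz => D.
    have [-> n1] := int_mul_nat_eq1 D.
    by rewrite E n1 /= gmul1.
  rewrite (hom_onV subT hdeg) // (hom_onX subT hdeg) // -mulr_natr natz => D.
  move: D; rewrite -mulNr => /int_mul_nat_eq1[D n1].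
  have -> : deg c = -1 by rewrite -D opprK.
  by rewrite E n1 /= gmul1.
by apply: (@evec_inj (scar t)); rewrite -!(level_pi lv) !key.
Qed.

Fixpoint tower_map (s : solution) m : scar s -> scar (iter m retract s) :=
  match m with
  | 0 => id
  | m'.+1 => fun x => @ret_cls (iter m' retract s) (@tower_map s m' x)
  end.

Lemma towerP (s : solution) m : non_degenerate s -> symmetric_sol s ->
  [/\ non_degenerate (iter m retract s), symmetric_sol (iter m retract s),
      morphism (@tower_map s m) & forall y, exists x, @tower_map s m x = y].
Proof.
move=> nd sym; elim: m => [|m [ndm symm [mg mf] surj]].
  by split=> // y; exists y.
pose t := iter m retract s.
have csurj (a : scar (retract t)) : exists x, @ret_cls t x = a.
  by exists (val a); exact: ret_cls_val.
have cg x y := ret_cls_g ndm symm x y.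
have cf x y := ret_cls_f ndm symm x y.
split.
- exact: (image_non_degenerate csurj cg cf ndm).
- exact: (image_symmetric csurj cg cf symm).
- split=> x y; first by rewrite /tower_map -/tower_map mg; exact: cg.
  by rewrite /tower_map -/tower_map mf; exact: cf.
- move=> a; have [b <-] := csurj a; have [x <-] := surj b.
  by exists x.
Qed.

(** * Lexicographic order along the tower *)

Section LexPositive.
Variable X : finType.
Implicit Types v w : {ffun X -> int}.

Definition lexpos v := exists2 x, lead x v & 0 < v x.

Lemma lexpos0 : ~ lexpos 0.
Proof. by move=> [x _]; rewrite ffunE ltxx. Qed.

Lemma lexpos_total v : [\/ v = 0, lexpos v | lexpos (- v)].
Proof.
have [->|/lead_ex[x lx]] := pselect (v = 0); first by constructor 1.
have [x0|x0|x0] := ltgtP 0 (v x).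
- by constructor 2; exists x.
- by constructor 3; exists x; [exact: lead_opp|rewrite ffunE oppr_gt0].
- by case: lx; rewrite -x0 eqxx.
Qed.

Lemma lexposD v w : lexpos v -> lexpos w -> lexpos (v + w).
Proof.
move=> [x [vx lv] vx0] [y [wy lw] wy0].
have [xy|yx|/ord_inj/enum_rank_inj xy] := ltngtP (enum_rank x) (enum_rank y).
- have wx : w x = 0 by exact: lw.
  exists x; last by rewrite ffunE wx addr0.
  split; first by rewrite ffunE wx addr0.
  by move=> z zx; rewrite ffunE lv // lw ?addr0 // (ltn_trans zx).
- have vy : v y = 0 by exact: lv.
  exists y; last by rewrite ffunE vy add0r.
  split; first by rewrite ffunE vy add0r.
  by move=> z zy; rewrite ffunE lw // lv ?addr0 // (ltn_trans zy).
- subst y; have p : 0 < (v + w) x by rewrite ffunE addr_gt0.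
  exists x => //; split; first by rewrite gt_eqF.
  by move=> z zx; rewrite ffunE lv // lw // addr0.
Qed.

End LexPositive.

Section Tower.
Variables (G : group) (Y : nat -> finType).
Variables (rho : forall m, G -> {perm Y m}) (pi : forall m, G -> {ffun Y m -> int}).
Variable M : nat.
Hypothesis cc : forall m, cocycle (@rho m) (@pi m).
Hypothesis pi0 : forall g, pi 0 g = 0 -> g = gone.
Hypothesis piS : forall m g, pi m g = 0 -> pi m.+1 g = 0.
Hypothesis rhoS : forall m g, pi m.+1 g = 0 -> rho m g = 1%g.
Hypothesis rhoTop : forall g, rho M g = 1%g.

Let dead m g := forall j, (m < j)%N -> (j <= M)%N -> pi j g = 0.

Let dead_rho m j g : dead m g -> (m <= j)%N -> (j <= M)%N -> rho j g = 1%g.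
Proof.
move=> dg mj; rewrite leq_eqVlt => /orP[/eqP->|jM]; first exact: rhoTop.
by apply: rhoS; apply: dg => //; rewrite ltnS.
Qed.

(** The highest level with nonzero cocycle decides the sign; on elements dead above level m, rho_m
    is trivial and pi_m additive. *)
Definition towerpos : set G :=
  [set g | exists m, [/\ (m <= M)%N, dead m g & lexpos (pi m g)]].

Let top_level g : g <> gone -> exists m, [/\ (m <= M)%N, dead m g & pi m g <> 0].
Proof.
move=> g1; pose Q m := (m <= M)%N && `[< pi m g <> 0 >].
have exQ : exists m, Q m.
  by exists 0%N; rewrite /Q leq0n /=; apply/asboolP => /pi0.
have bQ m : Q m -> (m <= M)%N by case/andP.
case: (ex_maxnP exQ bQ) => m /andP[mM /asboolP mg] mmax.
exists m; split=> // j mj jM; apply: contrapT => jg.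
have := mmax j; rewrite /Q jM leqNgt mj => /(_ (introT (asboolP _) jg)).
by [].
Qed.

Lemma towerpos_cone : cone setT towerpos.
Proof.
split=> //.
- by move=> [m [_ _]]; rewrite (pi1 (cc m)); exact: lexpos0.
- move=> g h [m [mM dg pg]] [m' [mM' dh ph]].
  have tr j : (m <= j)%N -> (j <= M)%N -> pi j (gmul g h) = pi j g + pi j h.
    by move=> mj jM; rewrite (pi_triv (cc j)) //; exact: dead_rho dg _ _.
  have [mm|mm|E] := ltngtP m m'.
  + exists m'; split=> //.
      move=> j j1 j2; have mj := ltn_trans mm j1.
      by rewrite tr ?(ltnW mj) // dg // dh // addr0.
    by rewrite tr ?(ltnW mm) // dg // add0r.
  + exists m; split=> //.
      move=> j j1 j2; have mj := ltn_trans mm j1.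
      by rewrite tr ?(ltnW j1) // dg // dh // addr0.
    by rewrite tr // [pi m h]dh // addr0.
  + subst m'; exists m; split=> //.
      by move=> j j1 j2; rewrite tr ?(ltnW j1) // dg // dh // addr0.
    by rewrite tr //; exact: lexposD.
- move=> g _; have [->|/top_level[m [mM dg g0]]] := pselect (g = gone).
    by constructor 1.
  case: (lexpos_total (pi m g)) => [//|pg|pg]; first by constructor 2; exists m.
  have tr j : (m <= j)%N -> (j <= M)%N -> pi j (ginv g) = - pi j g.
    by move=> mj jM; rewrite (pi_trivV (cc j)) //; exact: dead_rho dg _ _.
  constructor 3; exists m; split=> //; last by rewrite tr.
  by move=> j j1 j2; rewrite tr ?(ltnW j1) // dg // oppr0.
Qed.

Lemma towerpos_conj a h : (forall m, (m <= M)%N -> rho m a = 1%g) ->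
  towerpos h -> towerpos (gmul (ginv a) (gmul h a)).
Proof.
move=> ra [m [mM dh ph]].
have tr j : (m <= j)%N -> (j <= M)%N -> pi j (gmul (ginv a) (gmul h a)) = pi j h.
  move=> mj jM; have raj := ra j jM.
  rewrite (pi_triv (cc j)); last by rewrite (rhoV (cc j)) raj invg1.
  rewrite (pi_trivV (cc j)) // (pi_triv (cc j)); last exact: dead_rho dh _ _.
  by rewrite addrCA addNr addr0.
exists m; split=> //; last by rewrite tr.
by move=> j j1 j2; rewrite tr ?(ltnW j1) // dh.
Qed.

Lemma tower_exponent : exists2 N : nat, (0 < N)%N &
  forall g i m, (m <= M)%N -> rho m (gexp G g (i * N)) = 1%g.
Proof.
have [N N0 HN] : exists2 N : nat, (0 < N)%N &
    forall m, (m <= M)%N -> (#|{perm Y m}| %| N)%N.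
  elim: M => [|k [N N0 IH]].
    exists #|{perm Y 0}|; first by apply/card_gt0P; exists 1%g.
    by move=> m; rewrite leqn0 => /eqP->.
  exists (N * #|{perm Y k.+1}|)%N.
    by rewrite muln_gt0 N0; apply/card_gt0P; exists 1%g.
  move=> m; rewrite leq_eqVlt => /orP[/eqP->|mk]; first exact: dvdn_mull.
  by apply: dvdn_mulr; exact: IH.
exists N => // g i m mM; have /dvdnP[k ->] := HN m mM.
rewrite mulnA (rhoX (cc m)) mulnC expgM -(rhoX (cc m)) (rhoX_card (cc m)).
by rewrite expg1n.
Qed.

(** At the highest level where [pi] does not vanish on [H], it restricts to a homomorphism on [H],
    and a nonzero coordinate serves as psi; [piS] makes it vanish where pi_k does. *)
Lemma tower_indicable k (H : set G) : (k <= M)%N -> is_subgroup H ->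
  ~ (H `<=` [set g | pi k g = 0]) ->
  exists psi : G -> int, [/\ hom_on H psi,
    forall h, H h -> pi k h = 0 -> psi h = 0 & exists2 h, H h & psi h != 0].
Proof.
move=> kM sH nHK; pose Q m := [&& (k <= m)%N, (m <= M)%N &
  `[< exists2 h, H h & pi m h <> 0 >]].
have exQ : exists m, Q m.
  exists k; rewrite /Q leqnn kM /=; apply/asboolP; apply: contrapT => H'.
  apply: nHK => h Hh; apply: contrapT => ph; apply: H'.
  by exists h.
have bQ m : Q m -> (m <= M)%N by case/and3P.
case: (ex_maxnP exQ bQ) => m /and3P[km mM /asboolP[h Hh mh]] mmax.
have dH g : H g -> dead m g.
  move=> Hg j mj jM; apply: contrapT => jg; have := mmax j.
  rewrite /Q jM (leq_trans km (ltnW mj)) /= leqNgt mj.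
  by move=> /(_ (introT (asboolP _) _)) F; have : false by apply: F; exists g.
have [x hx] : exists x, pi m h x != 0.
  apply: contrapT => nx; apply: mh; apply/ffunP => x; rewrite ffunE.
  by apply/eqP/negPn/negP => hx; apply: nx; exists x.
exists (fun g => pi m g x); split.
- move=> a b Ha Hb; rewrite (pi_triv (cc m)) ?ffunE //.
  exact: (dead_rho (dH _ Ha)).
- move=> g _ gk; have : pi m g = 0.
    by rewrite -(subnKC km); elim: (m - k)%N => [|j IH]; rewrite ?addn0 // addnS; exact: piS.
  by move=> ->; rewrite ffunE.
- by exists h.
Qed.

End Tower.

(** * Left orders and their positive cones *)

Section OrdersAndCones.
Variable G : group.

Definition order_of_cone (P : set G) : LOspace G :=
  fun p => `[< P (gmul (ginv p.1) p.2) >].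

Definition cone_of_order (o : LOspace G) : set G := [set g | o (gone, g)].

Lemma order_of_cone_LO P : cone setT P -> LO G (order_of_cone P).
Proof.
move=> cP; split.
- by move=> a; apply/asboolP => /=; rewrite gmulV; exact: (cone1 cP).
- move=> a b c /asboolP /= ab /asboolP /= bc; apply/asboolP => /=.
  by have := coneM cP ab bc; rewrite -gmulA gmulKV.
- move=> a b; case: (@cone_total _ _ _ cP (gmul (ginv a) b)) => // [E|E|E].
  + by left; rewrite -(gmulKV a b) E gmulr1.
  + by right; left; apply/asboolP.
  + by right; right; apply/asboolP; move: E; rewrite ginvM ginvK.
- move=> a b c /asboolP /= ab; apply/asboolP => /=.
  by rewrite ginvM -gmulA gmulK.
Qed.

Lemma LO_coneE (o : LOspace G) a b : LO G o ->
  o (a, b) <-> cone_of_order o (gmul (ginv a) b).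
Proof.
move=> [_ _ _ inv]; split=> H; rewrite /cone_of_order /=.
  by have := inv a b (ginv a) H; rewrite gmulV.
by have := inv _ _ a H; rewrite gmulr1 gmulKV.
Qed.

Lemma cone_of_order_cone (o : LOspace G) : LO G o -> cone setT (cone_of_order o).
Proof.
move=> LOo; have [irr tr tot inv] := LOo; split=> //.
- by apply/negP; exact: irr.
- by move=> a b Pa Pb; apply: (tr _ a) => //; apply/LO_coneE => //; rewrite gmulK.
- move=> a _; case: (tot gone a) => [<-|[Pa|Pa]].
  + by constructor 1.
  + by constructor 2.
  + by constructor 3; move: Pa; rewrite LO_coneE // gmulr1.
Qed.

(** Each axiom of a left order involves at most three pairs. *)
Lemma LO_closed (x : LOspace G) :
  (forall p q r, exists y, [/\ LO G y, x p = y p, x q = y q & x r = y r]) ->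
  LO G x.
Proof.
move=> H; split.
- by move=> a; have [y [[irr _ _ _] -> _ _]] := H (a, a) (a, a) (a, a); exact: irr.
- move=> a b c; have [y [[_ tr _ _] -> -> ->]] := H (a, b) (b, c) (a, c).
  exact: tr.
- move=> a b; have [y [[_ _ tot _] -> -> _]] := H (a, b) (b, a) (a, a).
  exact: tot.
- move=> a b c.
  have [y [[_ _ _ inv] -> -> _]] := H (a, b) (gmul c a, gmul c b) (a, a).
  exact: inv.
Qed.

Lemma LO_homeomorphic_to_cantor (d : nat -> G * G) :
  (forall p, exists n, d n = p) -> (exists o, LO G o) ->
  (forall P : set G, cone setT P -> nonisolated setT P) ->
  homeomorphic_to_cantor (LO G).
Proof.
move=> d_surj LO0 ni; apply: (perfect_cube_homeomorphic d_surj) => //.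
  move=> x H; apply: LO_closed => p q r.
  have [np ep] := d_surj p; have [nq eq] := d_surj q; have [nr er] := d_surj r.
  have [y LOy xy] := H (maxn np (maxn nq nr)).+1.
  by exists y; split=> //; rewrite -?ep -?eq -?er xy // ltnS; lia.
move=> x n LOx; have cP := cone_of_order_cone LOx.
set P := cone_of_order x in cP.
(* Both quotients of a pair are listed, so that the new order also preserves the pairs on which [x]
   is false. *)
pose l := [seq gmul (ginv (d k).1) (d k).2 | k <- iota 0 n] ++
          [seq gmul (ginv (d k).2) (d k).1 | k <- iota 0 n].
have in_iota k : (k < n)%N -> List.In k (iota 0 n).
  move=> kn; have : k \in iota 0 n by rewrite mem_iota.
  elim: (iota 0 n) => // i s IH.
  by rewrite in_cons => /orP[/eqP->|/IH]; [left|right].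
have inl1 k : (k < n)%N -> List.In (gmul (ginv (d k).1) (d k).2) l.
  move=> kn; apply/List.in_or_app; left; apply/List.in_map_iff.
  by exists k; split=> //; exact: in_iota.
have inl2 k : (k < n)%N -> List.In (gmul (ginv (d k).2) (d k).1) l.
  move=> kn; apply/List.in_or_app; right; apply/List.in_map_iff.
  by exists k; split=> //; exact: in_iota.
have [|P' [cP' PF [h Ph P'h]]] := ni P cP (List.filter (fun f => `[< P f >]) l).
  by move=> f /List.filter_In[_ /asboolP].
have keep f : List.In f l -> P f -> P' f.
  by move=> lf Pf; apply: PF; apply/List.filter_In; split=> //; exact/asboolP.
exists (order_of_cone P'); split; first exact: order_of_cone_LO.
  move=> k kn; have := inl1 k kn; have := inl2 k kn.
  case: (d k) => a b /= l2 l1; rewrite /order_of_cone /=.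
  apply/idP/asboolP => [|P'ab].
    by rewrite LO_coneE // => Pab; exact: keep.
  rewrite LO_coneE // -/P.
  case: (@cone_total _ _ _ cP (gmul (ginv a) b)) => // E.
    by move: P'ab; rewrite E => /(cone1 cP').
  case: (cone_asym cP' P'ab); move: E; rewrite ginvM ginvK.
  exact: keep.
move=> E; have : x (gone, h) by [].
rewrite -E => /asboolP /=; rewrite ginv1 gmul1 => P'h'.
exact: (cone_asym cP' P'h').
Qed.

(** The indicator sequences of single positions give points of [A] from which the position can be
    recovered. *)
Lemma infinite_cantor_homeomorphic (T : topologicalType) (A : set T) :
  homeomorphic_to_cantor A -> ~ finite_set A.
Proof.
move=> [f [h [_ fh _ _]]] finA; apply: infinite_nat.
pose phi x := xget 0%N [set k | f x k].
apply: sub_finite_set (finite_image phi finA) => n _.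
pose c : cantor_space := fun k => k == n.
have [Ah fc] := fh c; exists (h c) => //.
rewrite /phi fc; have : [set k | c k] (xget 0%N [set k | c k]).
  by apply: xgetPex; exists n; rewrite /= /c eqxx.
by rewrite /= /c => /eqP.
Qed.

(** Take n_i = iN: a g^(iN) < b g^(iN) means that the conjugate of a^-1 b by g^(iN) is positive. *)
Lemma recurrent_order (P : set G) (N : nat) : (0 < N)%N ->
  (forall g i h, P h ->
     P (gmul (ginv (gexp G g (i * N))) (gmul h (gexp G g (i * N))))) ->
  recurrent (fun a b : G => order_of_cone P (a, b)).
Proof.
move=> N0 inv g hs shs; exists (fun i => i * N)%N; split.
  by move=> K; exists K => i Ki; rewrite (leq_trans Ki) // leq_pmulr.
move=> i; apply: homo_sorted shs => a b /asboolP /= Pab; apply/asboolP => /=.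
by have := inv g i _ Pab; rewrite ginvM -!gmulA.
Qed.

End OrdersAndCones.

(** * Drops in the tower of retracts, and the theorem *)

Lemma last_large (c : nat -> nat) M : (3 <= c 0)%N -> (c M <= 2)%N ->
  exists m, [/\ (m < M)%N, (3 <= c m)%N & (c m.+1 <= 2)%N].
Proof.
move=> c0; elim: M => [|M IH] cM; first by move: c0; rewrite leqNgt ltnS cM.
have [le2|gt2] := leqP (c M) 2; last by exists M.
by have [m [mM H1 H2]] := IH le2; exists m; split=> //; exact: ltnW.
Qed.

Lemma level_quotient (s t : solution) (G : group) (iota : scar s -> G)
    (c : scar s -> scar t) rho pi x y :
  level iota c rho pi -> sg t (c x) =1 sg t (c y) ->
  pi (gmul (iota x) (ginv (iota y))) = evec (c x) - evec (c y).
Proof.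
move=> lv E; have cc := level_cc lv.
have rE : rho (iota x) = rho (iota y).
  by apply/permP => z; rewrite !(level_rho lv).
by rewrite (piM cc) (piV cc) !(level_pi lv) pactN -pactM rE mulVg pact1.
Qed.

Section RankTwo.
Variables (s : solution) (G : group) (iota : scar s -> G).
Hypothesis sG : is_structure_group s G iota.
Variables (t : solution) (c : scar s -> scar t).
Hypotheses (nd : non_degenerate t) (sym : symmetric_sol t).
Hypothesis c_surj : forall y, exists x, c x = y.
Variables (rho : G -> {perm scar t}) (pi : G -> {ffun scar t -> int}).
Hypothesis lv : level iota c rho pi.

Variables (rho' : G -> {perm scar (retract t)})
          (pi' : G -> {ffun scar (retract t) -> int}).
Let c' x : scar (retract t) := ret_cls (c x).
Hypothesis lv' : level iota c' rho' pi'.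

Let nonrep (x : scar t) := canon x != x.

Let card_nonrep : (#|[pred x | nonrep x]| + #|scar (retract t)| = #|scar t|)%N.
Proof.
rewrite -(cardC [pred x | nonrep x]); congr addn; rewrite /= /ret_car card_sig.
by apply: eq_card => x; rewrite !inE negbK.
Qed.

(** Each z that is not a chosen representative gives an element with pi' = 0 and pi = e_z - e_(canon
    z). For two such points, their coordinates give the identity matrix. *)
Lemma retract_rank2 : (#|scar (retract t)| + 2 <= #|scar t|)%N ->
  exists x y a b, [/\ pi' a = 0, pi' b = 0 &
    pi a x * pi b y != pi b x * pi a y].
Proof.
rewrite -card_nonrep addnC leq_add2r => /card_gt1P[x [y []]].
rewrite !inE => nx ny xy.
have diff z : exists a, pi' a = 0 /\ pi a = evec z - evec (canon z).
  have [z1 z1E] := c_surj z; have [z2 z2E] := c_surj (canon z).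
  have cE : c' z1 = c' z2.
    rewrite /c' z1E z2E; apply/ret_clsP => w; exact/esym/canon_f.
  exists (gmul (iota z1) (ginv (iota z2))); split.
    by rewrite (level_quotient lv') cE ?subrr.
  have E : sg t (c z1) =1 sg t (c z2).
    by rewrite z1E z2E; apply: sf_eq_sg => // w; rewrite canon_f.
  by rewrite (level_quotient lv) // z1E z2E.
have [a [a' aE]] := diff x; have [b [b' bE]] := diff y.
exists x, y, a, b; split=> //; rewrite aE bE !ffunE !eqxx.
have rep u w : nonrep u -> (u == canon w) = false.
  by move=> nu; apply/negbTE/negP => /eqP uw; move: nu; rewrite /nonrep uw canon_canon.
have xyF : (x == y) = false by exact: negbTE.
by rewrite !rep // [y == x]eq_sym xyF.
Qed.

(** The class with two elements is fixed by [G], so its coordinate of [pi'] is a homomorphism,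
    independent of the total degree. *)
Lemma retract_two_homs : #|scar t| = 3%N -> #|scar (retract t)| = 2%N ->
  exists phi1 phi2 : G -> int, [/\ hom_on setT phi1, hom_on setT phi2 &
    exists a b, phi1 a * phi2 b != phi1 b * phi2 a].
Proof.
move=> card3 card2; have cc' := level_cc lv'.
have n1 : #|[pred x | nonrep x]| = 1%N by move: card_nonrep; rewrite card3 card2; lia.
have [x nx only] : exists2 x, nonrep x & forall z, nonrep z -> z = x.
  have /card_gt0P[x] : (0 < #|[pred x | nonrep x]|)%N by rewrite n1.
  rewrite inE => nx; exists x => // z nz; apply: contrapT => zx.
  have : (1 < #|[pred x | nonrep x]|)%N.
    by apply/card_gt1P; exists z, x; rewrite !inE nx nz; split=> //; exact/eqP.
  by rewrite n1.
pose k : scar (retract t) := ret_cls x.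
have fixk g : rho' g k = k.
  have kE : k = ret_cls (canon x) by apply/ret_clsP => w; rewrite canon_f.
  have E1 : rho' g k = ret_cls (rho g x) by exact: (level_compat sG nd sym lv lv').
  have E2 : rho' g k = ret_cls (rho g (canon x)).
    by rewrite kE; exact: (level_compat sG nd sym lv lv').
  (* If neither image were [x], both would be representatives of the same class, hence equal,
     against injectivity of [rho g]. *)
  have [/only r1|r1] := boolP (nonrep (rho g x)); first by rewrite E1 r1.
  have [/only r2|r2] := boolP (nonrep (rho g (canon x))); first by rewrite E2 r2.
  have /(congr1 val) /= : ret_cls (rho g x) = ret_cls (rho g (canon x)).
    by rewrite -E1 -E2.
  move/negPn/eqP: r1 => ->; move/negPn/eqP: r2 => -> /perm_inj E.
  by move: nx; rewrite /nonrep -E eqxx.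
pose phi1 g := pi' g k; pose phi2 g := \sum_z pi' g z.
exists phi1, phi2; split.
- move=> a b _ _; rewrite /phi1 (piM cc') !ffunE; congr (_ + pi' b _).
  by apply: (@perm_inj _ (rho' a)); rewrite permKV fixk.
- move=> a b _ _; rewrite /phi2 (piM cc'); under eq_bigr do rewrite !ffunE.
  rewrite big_split /=; congr (_ + _).
  by rewrite [RHS](reindex_inj (@perm_inj _ (rho' a)^-1%g)).
have [k2 k2k] : exists k2, k2 != k.
  have /card_gt1P[u [v [_ _ uv]]] : (1 < #|scar (retract t)|)%N by rewrite card2.
  have [uk|uk] := eqVneq u k; last by exists u.
  by exists v; rewrite -uk eq_sym.
have lift w : exists a, pi' a = evec w.
  have [y yE] := c_surj (val w); exists (iota y).
  by rewrite (level_pi lv') /c' yE ret_cls_val.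
have [a aE] := lift k; have [b bE] := lift k2; exists a, b.
have sum1 w : \sum_z evec w z = 1 :> int.
  rewrite (bigD1 w) //= ffunE eqxx big1 ?addr0 // => z zw.
  by rewrite ffunE (negbTE zw).
rewrite /phi1 /phi2 aE bE !sum1 !ffunE eqxx.
by rewrite [k == k2]eq_sym (negbTE k2k).
Qed.

End RankTwo.

Lemma countable_pairs (G : group) (C : countType) (pi : G -> C) :
  injective pi -> exists d : nat -> G * G, forall p, exists n, d n = p.
Proof.
move=> inj.
have /choice[d dP] : forall n, exists p, forall q : G * G,
    unpickle n = Some (pi q.1, pi q.2) -> p = q.
  move=> n; have [[q qn]|no] := pselect (exists q : G * G,
      unpickle n = Some (pi q.1, pi q.2)).
    exists q => -[a b]; rewrite qn; case: (q) => a' b' /=.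
    by move=> [/inj-> /inj->].
  by exists (gone, gone) => q qn; case: no; exists q.
by exists d => q; exists (pickle (pi q.1, pi q.2)); apply: dP; rewrite pickleK.
Qed.

Theorem theorem2 (s : solution) :
  (3 <= #|scar s|)%N -> is_solution s -> non_degenerate s -> symmetric_sol s ->
  ~ trivial_sol s -> retractable s ->
  forall (G : group) (iota : scar s -> G), is_structure_group s G iota ->
  [/\ (exists o : LOspace G, LO G o /\ recurrent (fun a b : G => o (a, b))),
      homeomorphic_to_cantor (LO G) &
      infinite_set [set o : LOspace G | LO G o /\ conradian (fun a b : G => o (a, b))]].
Proof.
move=> card3 _ nd sym _ [M [_ [G' [iota' [sG' cyc]]]]] G iota sG.
pose t m := iter m retract s.
have tP m : [/\ non_degenerate (t m), symmetric_sol (t m),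
    morphism (@tower_map s m) & forall y, exists x, @tower_map s m x = y].
  exact: towerP.
have [lv lvP] : exists lv : forall m, (G -> {perm scar (t m)}) *
      (G -> {ffun scar (t m) -> int}),
    forall m, level iota (@tower_map s m) (lv m).1 (lv m).2.
  have lev m : {p : (G -> {perm scar (t m)}) * (G -> {ffun scar (t m) -> int}) |
      level iota (@tower_map s m) p.1 p.2}.
    apply: cid; have [ndm symm mm _] := tP m.
    by have [rho [pi l]] := level_ex sG ndm symm mm; exists (rho, pi).
  by exists (fun m => sval (lev m)) => m; exact: (svalP (lev m)).
pose rho m := (lv m).1; pose pi m := (lv m).2.
have lvP' m : level iota (@tower_map s m) (rho m) (pi m) by exact: lvP.
have cc m : cocycle (rho m) (pi m) by exact: level_cc (lvP' m).
have pi_inj : injective (pi 0%N) by exact: (level0_inj sG nd sym (lvP' 0%N)).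
have pi0 g : pi 0%N g = 0 -> g = gone.
  by move=> g0; apply: pi_inj; rewrite g0 (pi1 (cc 0%N)).
have piS m g : pi m g = 0 -> pi m.+1 g = 0.
  have [ndm symm _ _] := tP m.
  have := level_pi_retract sG ndm symm (lvP' m) (lvP' m.+1) (a := g) (b := gone).
  by rewrite !(pi1 (cc _)).
have rhoS m g : pi m.+1 g = 0 -> rho m g = 1%g.
  have [ndm symm _ _] := tP m.
  have := level_rho_retract sG ndm symm (lvP' m) (lvP' m.+1) (a := g) (b := gone).
  by rewrite (pi1 (cc _)) (rho1 (cc _)).
have tM1 : forall x y : scar (t M), x = y.
  have [ndM symM _ _] := tP M.
  exact: (cyclic_subsingleton ndM symM sG' cyc).
have rhoTop g : rho M g = 1%g by apply/permP => x; exact: tM1.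
have ni (P : set G) : cone setT P -> nonisolated setT P.
  move=> cP.
  have cM : (#|scar (t M)| <= 2)%N.
    by apply: leqW; apply/fintype_le1P => x y; exact: tM1.
  have [m [mM ge3 le2]] := @last_large (fun m => #|scar (t m)|) M card3 cM.
  have [ndm symm _ surj] := tP m.
  have [drop2|drop1] := leqP (#|scar (t m.+1)| + 2) #|scar (t m)|.
    have [x [y [a [b [a0 b0 det]]]]] :=
      retract_rank2 ndm symm surj (lvP' m) (lvP' m.+1) drop2.
    pose K := [set g | pi m.+1 g = 0].
    have hom z : hom_on K (fun g => pi m g z).
      by move=> g h /rhoS Kg _; rewrite (pi_triv (cc m)) // ffunE.
    apply: (nonisolated_rank2 Rdefinitions.R (cc 0%N) pi0 (hom x) (hom y) _
      subT cP _ a0 _ b0 det) => // H sH nHK.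
    exact: (tower_indicable cc piS rhoS rhoTop mM sH nHK).
  (* A drop of less than two across the bound 2 can only go from 3 to 2. *)
  have [c3 c2] : #|scar (t m)| = 3%N /\ #|scar (t m.+1)| = 2%N.
    by move: ge3 le2 drop1 => /=; lia.
  have [phi1 [phi2 [h1 h2 [a [b det]]]]] :=
    retract_two_homs sG ndm symm surj (lvP' m) (lvP' m.+1) c3 c2.
  exact: (nonisolated_two_homs Rdefinitions.R (cc 0%N) pi0 subT cP h1 h2 _ _ det).
have cT := towerpos_cone cc pi0 rhoS rhoTop.
have LOT := order_of_cone_LO cT.
have [d d_surj] := countable_pairs pi_inj.
have homeo : homeomorphic_to_cantor (LO G).
  by apply: (LO_homeomorphic_to_cantor d_surj _ ni); eexists; exact: LOT.
split=> //.
  exists (order_of_cone (towerpos pi M)); split=> //.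
  have [N N0 HN] := tower_exponent M cc.
  apply: (recurrent_order N0) => g i h.
  by apply: (towerpos_conj cc rhoS rhoTop) => m mM; exact: HN.
(* Every left order is Conradian, with b < a b^2 for all positive a and b, so the set is all of
   [LO G]. *)
move=> fin; apply: (infinite_cantor_homeomorphic homeo).
apply: sub_finite_set fin => o LOo; split=> // a b Pa Pb.
exists 1%N; apply/LO_coneE => //.
exact: (order_conradian Rdefinitions.R (cc 0%N) pi0 (cone_of_order_cone LOo)).
Qed.
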